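(* Let $n\ge3$ and let $\lambda,\sigma$ be constants with $$0\le\sigma\le\lambda\le\frac{n}{n-2}.$$ Let $f,g:(0,\infty)\to(0,\infty)$ be continuous functions satisfying $f(t)=O(t^\lambda)$ and $g(t)=O(t^\sigma)$ as $t\to\infty$. Suppose $u(x)$ and $v(x)$ are $C^2$ positive solutions of the system $$0\le-\Delta u\le f(v),\qquad 0\le-\Delta v\le g(u)$$ in a punctured neighborhood of the origin in $\mathbb{R}^n$. Then $$u(x)=O(|x|^{-(n-2)})\quad\text{and}\quad v(x)=O(|x|^{-(n-2)})\quad\text{as }x\to0.$$ *)

(* Defs.v *)
From HB Require Import structures.
From mathcomp Require Import all_boot all_order all_algebra.
From mathcomp Require Import all_classical all_reals all_analysis.

Set Implicit Arguments.
Unset Strict Implicit.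
Unset Printing Implicit Defensive.
Import Order.TTheory GRing.Theory Num.Theory.
Import numFieldNormedType.Exports.

Local Open Scope classical_set_scope.
Local Open Scope ring_scope.

(* The library norm `|x| on 'rV[R]_n is the sup norm, hence this definition. *)
Definition euclidean_norm (R : realType) (n : nat) (x : 'rV[R]_n) : R :=
  Num.sqrt (\sum_(i < n) x ord0 i ^+ 2).

Definition partial (R : realType) (n : nat) (i : 'I_n) (u : 'rV[R]_n -> R) :
    'rV[R]_n -> R :=
  'D_(delta_mx ord0 i) u.

Definition laplacian (R : realType) (n : nat) (u : 'rV[R]_n -> R) :
    'rV[R]_n -> R :=
  fun x => \sum_(i < n) partial i (partial i u) x.

(* C^k regularity on A, meant for A open: [derivable] and [partial] at a point
   of A look at values in a neighbourhood of that point, so for A open only the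
   values of u on A matter. *)
Fixpoint C_on (R : realType) (n k : nat) (A : set 'rV[R]_n)
    (u : 'rV[R]_n -> R) : Prop :=
  (forall x, A x -> {for x, continuous u}) /\
  if k is k'.+1 then
    forall i : 'I_n,
      (forall x, A x -> derivable u x (delta_mx ord0 i)) /\
      C_on k' A (partial i u)
  else True.

(* Lets the library's Landau notation [=O_F] be used at F = +oo. *)
Canonical pinfty_nbhs_filter_on (R : numFieldType) :=
  FilterType (pinfty_nbhs R) filter_filter.

(* Main.v *)
Require Import Defs.
From HB Require Import structures.
From mathcomp Require Import all_boot all_order all_algebra.
From mathcomp Require Import all_classical all_reals all_analysis.
From mathcomp Require Import ring lra.

(** Everything rests on the minimum principle.  Write N for n - 2 and G for the
    Newtonian kernel [newton], G(x) = |x|^-N.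

    A positive superharmonic function u on a punctured ball of radius r0 has a
    largest a >= 0 with a (G - r0^-N) <= u.  The remainder w = u - a (G - r0^-N)
    is nonnegative and superharmonic, and maximality of a forces
    min_{|x| = r} w = o(r^-N) as r -> 0: were w >= e r^-N on arbitrarily small
    spheres, comparison on annuli would allow a + e in place of a
    ([newton_coefficient]).

    If u is not O(G), it has peaks much higher than G.  Write such a peak value
    as u(x1) = r^-N, so that r is much smaller than |x1|, and choose the peak so
    that u and v are at most 2^N r^-N within distance r of x1; this is possible
    by maximising (s - |x - xb|)^N max(u, v) over a cube of half-side s centred
    at a bad point xb ([peak_selection]).  The exponent n/N is exactly the one
    for which the system then gives -Delta u <= k r^-n on that cube
    ([growth_bound]), and a function with these bounds cannot drop from r^-N to
    half of it within distance theta r, where theta depends only on n and k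
    ([oscillation_estimate]).  Thus w is at least r^-N / 4 on a ball of radius
    theta r.  Since r^-N (theta r)^N does not depend on r, the minimum principle
    spreads this to a bound w >= c |x1|^-N on whole spheres of radius comparable
    to |x1|, with c > 0 fixed ([punctured_barrier]).  For x1 close to the origin
    this contradicts min w = o(r^-N) ([no_high_peak]).  Taking the maximum of
    max(u, v) is what lets the same argument treat both components. *)

Set Implicit Arguments.
Unset Strict Implicit.
Unset Printing Implicit Defensive.
Import Order.TTheory GRing.Theory Num.Theory.
Import numFieldNormedType.Exports.

Local Open Scope classical_set_scope.
Local Open Scope ring_scope.

(** * Second differences and the Laplacian *)

(** The Laplacian enters only through the limit of symmetric second differences:
    that limit is linear, invariant under coordinate reflections and nonnegative
    at a local minimum, which is all that the minimum principle needs. *)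
Definition second_difference (R : realType) (n : nat) (w : 'rV[R]_n -> R)
    (x : 'rV[R]_n) (h : R) : R :=
  (\sum_(i < n) (w (x + h *: delta_mx ord0 i) + w (x - h *: delta_mx ord0 i)
                 - 2 * w x)) / h ^+ 2.

Definition has_laplacian (R : realType) (n : nat) (w : 'rV[R]_n -> R)
    (x : 'rV[R]_n) (L : R) : Prop :=
  second_difference w x h @[h --> 0^'] --> L.

Lemma has_laplacianD (R : realType) (n : nat) (w1 w2 : 'rV[R]_n -> R)
    (x : 'rV[R]_n) (L1 L2 : R) :
  has_laplacian w1 x L1 -> has_laplacian w2 x L2 ->
  has_laplacian (fun y => w1 y + w2 y) x (L1 + L2).
Proof.
move=> h1 h2; rewrite /has_laplacian.
rewrite (_ : second_difference _ x =
  (fun h => second_difference w1 x h + second_difference w2 x h)); last first.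
  apply/funext => h; rewrite /second_difference -mulrDl -big_split /=.
  by congr (_ / _); apply: eq_bigr => i _; ring.
exact: cvgD.
Qed.

Lemma has_laplacianZ (R : realType) (n : nat) (w : 'rV[R]_n -> R)
    (x : 'rV[R]_n) (L k : R) :
  has_laplacian w x L -> has_laplacian (fun y => k * w y) x (k * L).
Proof.
move=> h1; rewrite /has_laplacian.
rewrite (_ : second_difference _ x = (fun h => k * second_difference w x h)).
  exact: cvgMr.
apply/funext => h; rewrite /second_difference [RHS]mulrA mulr_sumr.
by congr (_ / _); apply: eq_bigr => i _; ring.
Qed.

Lemma has_laplacian_cst (R : realType) (n : nat) (k : R) (x : 'rV[R]_n) :
  has_laplacian (fun=> k) x 0.
Proof.
rewrite /has_laplacian (_ : second_difference _ x = fun=> 0); first exact: cvg_cst.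
apply/funext => h; rewrite /second_difference big1 ?mul0r// => i _; ring.
Qed.

Lemma has_laplacianB (R : realType) (n : nat) (w1 w2 : 'rV[R]_n -> R)
    (x : 'rV[R]_n) (L1 L2 : R) :
  has_laplacian w1 x L1 -> has_laplacian w2 x L2 ->
  has_laplacian (fun y => w1 y - w2 y) x (L1 - L2).
Proof.
move=> h1 /(has_laplacianZ (k := -1)) h2; have := has_laplacianD h1 h2.
rewrite mulN1r; congr has_laplacian; apply/funext => y; ring.
Qed.

Lemma has_laplacian_shift (R : realType) (n : nat) (w : 'rV[R]_n -> R)
    (x c : 'rV[R]_n) (L : R) :
  has_laplacian w (x - c) L -> has_laplacian (fun y => w (y - c)) x L.
Proof.
rewrite /has_laplacian (_ : second_difference w (x - c) =
  second_difference (fun y => w (y - c)) x) //.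
apply/funext => h; congr (_ / _).
by apply: eq_bigr => i _; rewrite !(addrAC x _ (- c)).
Qed.

Lemma has_laplacian_exact (R : realType) (n : nat) (w : 'rV[R]_n -> R)
    (x : 'rV[R]_n) (L : R) :
  (forall h, \sum_(i < n) (w (x + h *: delta_mx ord0 i) +
     w (x - h *: delta_mx ord0 i) - 2 * w x) = L * h ^+ 2) ->
  has_laplacian w x L.
Proof.
move=> H; apply: cvg_near_cst; near=> h.
rewrite /second_difference H mulfK// expf_neq0//.
by near: h; exact: nbhs_dnbhs_neq.
Unshelve. all: by end_near. Qed.

Lemma has_laplacian_sqr_coord (R : realType) (n : nat) (i : 'I_n)
    (x : 'rV[R]_n) :
  has_laplacian (fun y : 'rV[R]_n => y ord0 i ^+ 2) x 2.
Proof.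
apply: has_laplacian_exact => h.
rewrite (bigD1 i) //= big1 => [|j ji]; rewrite !mxE ?eqxx /=.
  by rewrite addr0; ring.
by rewrite eq_sym (negbTE ji) /=; ring.
Qed.

Lemma has_laplacian_coord (R : realType) (n : nat) (i : 'I_n)
    (x : 'rV[R]_n) :
  has_laplacian (fun y : 'rV[R]_n => y ord0 i) x 0.
Proof.
apply: has_laplacian_exact => h.
by rewrite big1 ?mul0r// => j _; rewrite !mxE; ring.
Qed.

Lemma has_laplacian_sqr_norm (R : realType) (n : nat) (x : 'rV[R]_n) :
  has_laplacian (fun y : 'rV[R]_n => \sum_(i < n) y ord0 i ^+ 2) x (2 * n%:R).
Proof.
apply: has_laplacian_exact => h.
transitivity (\sum_(i < n) 2 * h ^+ 2); last first.
  by rewrite sumr_const card_ord -[LHS]mulr_natr; ring.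
apply: eq_bigr => i _; rewrite mulr_sumr -big_split -sumrB /=.
rewrite (bigD1 i) //= big1 => [|j ji]; rewrite !mxE ?eqxx /=.
  by rewrite addr0; ring.
by rewrite (negbTE ji) /=; ring.
Qed.

Lemma has_laplacian_local_min (R : realType) (n : nat) (w : 'rV[R]_n -> R)
    (x : 'rV[R]_n) (L : R) :
  has_laplacian w x L -> (\forall y \near x, w x <= w y) -> 0 <= L.
Proof.
move=> wL wmin.
apply: (cvgr_to_ge wL).
have ev (i : 'I_n) (s : R) : \forall h \near (0 : R),
    w x <= w (x + (s * h) *: delta_mx ord0 i).
  have : x + (s * h) *: (delta_mx ord0 i : 'rV[R]_n) @[h --> (0 : R)]
      --> x + (s * 0) *: (delta_mx ord0 i : 'rV[R]_n).
    by apply: cvgD; [exact: cvg_cst|apply: cvgZr_tmp; apply: cvgMr].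
  by rewrite mulr0 scale0r addr0 => /(_ _ wmin).
have {}ev (i : 'I_n) : \forall h \near (0 : R),
    w x <= w (x + h *: delta_mx ord0 i) /\ w x <= w (x - h *: delta_mx ord0 i).
  have := ev i (-1); have := ev i 1.
  by apply: filterS2 => h; rewrite mul1r mulN1r scaleNr.
have {}ev := filter_forall (nbhs_filter (0 : R)) ev.
near=> h; rewrite /second_difference divr_ge0 ?sqr_ge0// sumr_ge0// => i _.
have : forall i : 'I_n,
    w x <= w (x + h *: delta_mx ord0 i) /\ w x <= w (x - h *: delta_mx ord0 i).
  by near: h; exact: nbhs_dnbhs.
by move=> /(_ i)[]; lra.
Unshelve. all: by end_near. Qed.

(** The remainder chi(t) = phi(t) + phi(-t) - 2 phi(0) - d t^2 is even and has
    chi'(s) = o(s), so chi(t) = o(t^2) by the mean value theorem on [0, t]. *)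
Lemma second_difference_cvg (R : realType) (phi phi1 : R -> R) (d : R) :
  (\forall t \near (0 : R), is_derive t (1 : R) phi (phi1 t)) ->
  is_derive (0 : R) (1 : R) phi1 d ->
  (phi t + phi (- t) - 2 * phi 0) / t ^+ 2 @[t --> 0^'] --> d.
Proof.
move=> dphi [dphi1 dE].
have {dE dphi1} cd : h^-1 *: (phi1 (h *: 1 + 0) - phi1 0) @[h --> 0^'] --> d.
  by rewrite -dE; exact: dphi1.
apply/cvgrPdist_le => e e0.
move/cvgrPdist_le: cd => /(_ (e / 2)); rewrite divr_gt0// => /(_ isT).
rewrite near_withinE => ncd.
have : \forall t \near (0 : R), is_derive t (1 : R) phi (phi1 t) /\
    `|phi1 t - phi1 0 - d * t| <= e / 2 * `|t|.
  near=> t; split; first by near: t.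
  have [->|t0] := eqVneq t 0; first by rewrite mulr0 !subrr !normr0 mulr0.
  have : t != 0 -> `|d - t^-1 *: (phi1 (t *: 1 + 0) - phi1 0)| <= e / 2.
    by near: t.
  move=> /(_ t0); rewrite /GRing.scale/= mulr1 addr0.
  rewrite -(ler_pM2r (_ : 0 < `|t|)) ?normr_gt0// -normrM distrC.
  rewrite mulrBl mulrAC mulVf// mul1r.
  by [].
move=> /nbhs_ballP[r /= r0 rB].
have pos (t : R) : 0 < t -> t < r ->
    `|phi t + phi (- t) - 2 * phi 0 - d * t ^+ 2| <= e * t ^+ 2.
  move=> t0 tr.
  pose chi s := phi s + phi (- s) - 2 * phi 0 - d * s ^+ 2.
  have dchi (s : R) : `|s| < r ->
      is_derive s (1 : R) chi (phi1 s - phi1 (- s) - 2 * d * s).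
    move=> sr.
    have [ds _] : is_derive s (1 : R) phi (phi1 s) /\
      `|phi1 s - phi1 0 - d * s| <= e / 2 * `|s|.
      by apply: rB; rewrite /ball/= sub0r normrN.
    have [dNs _] : is_derive (- s) (1 : R) phi (phi1 (- s)) /\
      `|phi1 (- s) - phi1 0 - d * - s| <= e / 2 * `|- s|.
      by apply: rB; rewrite /ball/= sub0r normrN normrN.
    have dN : is_derive s (1 : R) (fun s => phi (- s)) (phi1 (- s) * - 1).
      by apply: (@is_derive1_comp _ phi -%R).
    rewrite /chi.
    apply: is_derive_eq => /=.
    by rewrite /GRing.scale /=; ring.
  have [c] : exists2 c, c \in `]0, t[%R &
      chi t - chi 0 = (phi1 c - phi1 (- c) - 2 * d * c) * (t - 0).
    apply: MVT => //.
      by move=> s; rewrite in_itv /= => /andP[s0 st]; apply: dchi;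
        rewrite gtr0_norm// (lt_trans st).
    apply: derivable_within_continuous => s; rewrite in_itv /= => /andP[s0 st].
    by apply: ex_derive; apply: dchi; rewrite ger0_norm// (le_lt_trans st).
  rewrite in_itv /= => /andP[c0 ct].
  have -> : chi 0 = 0 by rewrite /chi oppr0; ring.
  rewrite !subr0 -/(chi t) => ->.
  have cr : c < r by exact: lt_trans tr.
  have [_ Bc] : is_derive c (1 : R) phi (phi1 c) /\
    `|phi1 c - phi1 0 - d * c| <= e / 2 * `|c|.
    by apply: rB; rewrite /ball/= sub0r normrN gtr0_norm.
  have [_ BNc] : is_derive (- c) (1 : R) phi (phi1 (- c)) /\
    `|phi1 (- c) - phi1 0 - d * - c| <= e / 2 * `|- c|.
    by apply: rB; rewrite /ball/= sub0r !normrN gtr0_norm.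
  rewrite normrN in BNc; rewrite (gtr0_norm c0) in Bc BNc.
  rewrite normrM (gtr0_norm t0) expr2 mulrA ler_pM2r//.
  apply: (@le_trans _ _ (e * c)); last by rewrite ler_pM2l// ltW.
  move: Bc BNc; rewrite !ler_norml => /andP[? ?] /andP[? ?].
  by apply/andP; split; lra.
near=> t.
have t0 : t != 0 by near: t; exact: nbhs_dnbhs_neq.
have tr : `|t| < r.
  have : ball 0 r t by near: t; apply: nbhs_dnbhs; exact: nbhsx_ballx.
  by rewrite /ball/= sub0r normrN.
have t2 : 0 < t ^+ 2 by rewrite exprn_even_gt0.
rewrite distrC -(ler_pM2r t2) -[X in _ * X <= _](gtr0_norm t2) -normrM mulrBl.
rewrite divfK ?gt_eqF//.
have [tp|tn|t00] := ltgtP 0 t; last by rewrite t00 eqxx in t0.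
  by apply: pos => //; rewrite -(gtr0_norm tp).
have := pos (- t); rewrite oppr_gt0 opprK sqrrN => /(_ tn).
by rewrite -(ltr0_norm tn) => /(_ tr); rewrite (addrC (phi _)).
Unshelve. all: by end_near. Qed.

Lemma cvg_sum_ord (R : realType) (T : Type) (F : set_system T) (n : nat)
    (f : 'I_n -> T -> R) (l : 'I_n -> R) :
  Filter F -> (forall i, f i t @[t --> F] --> l i) ->
  \sum_(i < n) f i t @[t --> F] --> \sum_(i < n) l i.
Proof.
move=> FF fl; elim: (index_enum _) => [|i s IH].
  by rewrite big_nil; under eq_fun do rewrite big_nil; exact: cvg_cst.
rewrite big_cons; under eq_fun do rewrite big_cons.
exact: cvgD.
Qed.

Lemma has_laplacian_of_derive (R : realType) (n : nat) (w : 'rV[R]_n -> R)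
    (x : 'rV[R]_n) (w1 : 'I_n -> R -> R) (d : 'I_n -> R) :
  (forall i, \forall t \near (0 : R),
     is_derive t (1 : R) (fun s => w (x + s *: delta_mx ord0 i)) (w1 i t)) ->
  (forall i, is_derive (0 : R) (1 : R) (w1 i) (d i)) ->
  has_laplacian w x (\sum_(i < n) d i).
Proof.
move=> dw dw1; rewrite /has_laplacian /second_difference.
under eq_fun do rewrite mulr_suml.
apply: cvg_sum_ord => i.
have := second_difference_cvg (dw i) (dw1 i).
rewrite scale0r addr0; under eq_fun do rewrite scaleNr.
by [].
Qed.

Lemma is_derive_line (R : realType) (n : nat) (w : 'rV[R]_n -> R)
    (x e : 'rV[R]_n) (t : R) :
  derivable w (x + t *: e) e ->
  is_derive t (1 : R) (fun s => w (x + s *: e)) ('D_e w (x + t *: e)).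
Proof.
have E : (fun h : R => h^-1 *: (((fun s => w (x + s *: e)) \o shift t) (h *: 1)
            - w (x + t *: e))) =
    (fun h => h^-1 *: ((w \o shift (x + t *: e)) (h *: e) - w (x + t *: e))).
  apply/funext => h /=; congr (_ *: (w _ - _)).
  by rewrite [h%:A]mulr1 scalerDl addrCA.
by move=> dw; split; rewrite /derivable /derive E.
Qed.

Lemma C2_has_laplacian (R : realType) (n : nat) (A : set 'rV[R]_n)
    (w : 'rV[R]_n -> R) (x : 'rV[R]_n) :
  open A -> C_on 2 A w -> A x -> has_laplacian w x (laplacian w x).
Proof.
move=> oA [_ cw] Ax; rewrite /laplacian.
apply: (@has_laplacian_of_derive _ _ _ _
  (fun i t => partial i w (x + t *: delta_mx ord0 i))) => i.
- have nA : \forall t \near (0 : R), A (x + t *: (delta_mx ord0 i : 'rV[R]_n)).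
    have : x + t *: (delta_mx ord0 i : 'rV[R]_n) @[t --> (0 : R)]
        --> x + 0 *: (delta_mx ord0 i : 'rV[R]_n).
      by apply: cvgD; [exact: cvg_cst|apply: cvgZr_tmp; exact: cvg_id].
    by rewrite scale0r addr0; apply; exact: open_nbhs_nbhs.
  apply: filterS nA => t At.
  by apply: is_derive_line; have [+ _] := cw i; exact.
- have [_ [_ /(_ i)[dpw _]]] := cw i.
  have := @is_derive_line _ _ (partial i w) x (delta_mx ord0 i) 0.
  by rewrite scale0r addr0; apply; exact: dpw.
Qed.

(** * The Euclidean norm and the Newtonian kernel *)

Definition newton (R : realType) (n : nat) (x : 'rV[R]_n) : R :=
  euclidean_norm x ^- (n - 2).

Definition sqr_norm (R : realType) (n : nat) (x : 'rV[R]_n) : R :=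
  \sum_(i < n) x ord0 i ^+ 2.

Lemma sqr_norm_ge0 (R : realType) (n : nat) (x : 'rV[R]_n) : 0 <= sqr_norm x.
Proof. by apply: sumr_ge0 => i _; exact: sqr_ge0. Qed.

Lemma sqr_norm_gt0 (R : realType) (n : nat) (x : 'rV[R]_n) :
  x != 0 -> 0 < sqr_norm x.
Proof.
move=> x0; rewrite lt_def sqr_norm_ge0 andbT; apply: contra x0.
rewrite psumr_eq0 => [/allP x0|i _]; last exact: sqr_ge0.
apply/eqP/rowP => i; rewrite mxE; apply/eqP.
by have := x0 i (mem_index_enum i); rewrite sqrf_eq0.
Qed.

Lemma newton_powR (R : realType) (n : nat) (x : 'rV[R]_n) :
  newton x = sqr_norm x `^ (- ((n - 2)%N%:R / 2)).
Proof.
rewrite /newton /euclidean_norm -/(sqr_norm x) -powR12_sqrt ?sqr_norm_ge0//.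
by rewrite -powR_invn ?powR_ge0// -powRrM mulrN mulrC.
Qed.

Lemma sqr_norm_line (R : realType) (n : nat) (x : 'rV[R]_n) (i : 'I_n) (t : R) :
  sqr_norm (x + t *: delta_mx ord0 i) = sqr_norm x + 2 * t * x ord0 i + t ^+ 2.
Proof.
rewrite /sqr_norm (bigD1 i) //= [in RHS](bigD1 i) //= !mxE !eqxx /=.
rewrite (eq_bigr (fun j => x ord0 j ^+ 2)); first by ring.
by move=> j ji; rewrite !mxE (negbTE ji) /= mulr0 addr0.
Qed.

(** With q = |x|^2 and p = -(n-2)/2, the second derivatives of q^p add up to
    p q^(p-1) (2 n + 4 (p - 1)), which vanishes for this p. *)
Lemma newton_harmonic (R : realType) (n : nat) (x : 'rV[R]_n) :
  (2 <= n)%N -> x != 0 -> has_laplacian (@newton R n) x 0.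
Proof.
move=> n2 x0.
set p : R := - ((n - 2)%N%:R / 2).
have q0 := sqr_norm_gt0 x0; set q := sqr_norm x in q0.
pose Q (i : 'I_n) (t : R) := q + 2 * t * x ord0 i + t ^+ 2.
have dQ i t : is_derive t (1 : R) (Q i) (2 * x ord0 i + 2 * t).
  rewrite /Q; apply: is_derive_eq => /=.
  by rewrite /GRing.scale /=; ring.
have Qgt0 i : \forall t \near (0 : R), 0 < Q i t.
  have : Q i t @[t --> (0 : R)] --> Q i 0.
    apply: differentiable_continuous.
    by apply/derivable1_diffP; have [] := dQ i 0.
  by move/cvgr_gt; apply; rewrite /Q; lra.
pose w1 i t := p * Q i t `^ (p - 1) * (2 * x ord0 i + 2 * t).
pose d (i : 'I_n) := p * q `^ (p - 1) * 2 +
  (2 * x ord0 i) ^+ 2 * (p * ((p - 1) * q `^ (p - 1 - 1))).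
have H : has_laplacian (@newton R n) x (\sum_(i < n) d i).
  apply: (@has_laplacian_of_derive _ _ _ _ w1) => i.
    near=> t; have Qt : 0 < Q i t by near: t; exact: Qgt0.
    rewrite (_ : (fun s => _) = (fun s => s `^ p) \o Q i); last first.
      by apply/funext => s /=; rewrite newton_powR sqr_norm_line.
    exact: (is_derive1_comp (is_derive1_powR p Qt) (dQ i t)).
  have Q0 : Q i 0 = q by rewrite /Q; ring.
  have dP : is_derive (0 : R) (1 : R) (fun t => Q i t `^ (p - 1))
      ((p - 1) * q `^ (p - 1 - 1) * (2 * x ord0 i + 2 * 0)).
    have Q0gt : 0 < Q i 0 by rewrite Q0.
    have := is_derive1_comp (is_derive1_powR (p - 1) Q0gt) (dQ i 0).
    by rewrite Q0.
  rewrite /w1; apply: is_derive_eq => /=.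
  by rewrite /d /GRing.scale /= Q0; ring.
suff -> : 0 = \sum_(i < n) d i :> R by [].
have -> : \sum_(i < n) d i = p * q `^ (p - 1) * 2 * n%:R +
    4 * (p * ((p - 1) * q `^ (p - 1 - 1))) * q.
  rewrite /d big_split /= sumr_const card_ord.
  rewrite [X in _ = _ + _ * X](_ : q = \sum_(i < n) x ord0 i ^+ 2)// mulr_sumr.
  congr (_ + _); first by rewrite [RHS]mulr_natr.
  by apply: eq_bigr => i _; ring.
have -> : q `^ (p - 1) = q * q `^ (p - 1 - 1).
  have := @powRD _ q 1 (p - 1 - 1); rewrite powRr1 ?ltW// => <-.
    by congr (_ `^ _); ring.
  by rewrite (gt_eqF q0) implybT.
by move: (q `^ (p - 1 - 1)) => X; rewrite /p natrB//; field.
Unshelve. all: by end_near. Qed.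

Lemma sqr_normE (R : realType) (n : nat) (x : 'rV[R]_n) :
  sqr_norm x = euclidean_norm x ^+ 2.
Proof. by rewrite /euclidean_norm sqr_sqrtr// sqr_norm_ge0. Qed.

Lemma euclidean_norm_ge0 (R : realType) (n : nat) (x : 'rV[R]_n) :
  0 <= euclidean_norm x.
Proof. exact: sqrtr_ge0. Qed.

Lemma euclidean_norm_gt0 (R : realType) (n : nat) (x : 'rV[R]_n) :
  x != 0 -> 0 < euclidean_norm x.
Proof. by move=> x0; rewrite sqrtr_gt0 sqr_norm_gt0. Qed.

Lemma euclidean_norm_gt0_neq0 (R : realType) (n : nat) (x : 'rV[R]_n) :
  0 < euclidean_norm x -> x != 0.
Proof.
apply: contraTneq => ->; rewrite /euclidean_norm big1 ?sqrtr0 ?ltxx// => i _.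
by rewrite mxE expr0n.
Qed.

Lemma ler_coord_norm (R : realType) (n : nat) (x : 'rV[R]_n) (i : 'I_n) :
  `|x ord0 i| <= `|x|.
Proof.
have -> : `|x| = mx_norm x by [].
by rewrite mx_normrE; apply/bigmax_geP; right => /=; exists (ord0, i).
Qed.

Lemma norm_le_coord (R : realType) (n : nat) (x : 'rV[R]_n) (a : R) :
  0 <= a -> (forall i, `|x ord0 i| <= a) -> `|x| <= a.
Proof.
move=> a0 H; have -> : `|x| = mx_norm x by [].
rewrite mx_normrE; apply/bigmax_leP; split => //.
by move=> [i j] _ /=; rewrite ord1.
Qed.

Lemma coord_le_euclidean (R : realType) (n : nat) (x : 'rV[R]_n) (i : 'I_n) :
  `|x ord0 i| <= euclidean_norm x.
Proof.
rewrite -sqrtr_sqr; apply: ler_wsqrtr; rewrite (bigD1 i)//= lerDl.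
by apply: sumr_ge0 => j _; exact: sqr_ge0.
Qed.

Lemma norm_le_euclidean (R : realType) (n : nat) (x : 'rV[R]_n) :
  `|x| <= euclidean_norm x.
Proof.
by apply: norm_le_coord => [|i]; [exact: euclidean_norm_ge0|exact: coord_le_euclidean].
Qed.

(** The library norm is the sup norm; comparing the two norms replaces the
    triangle inequality for the Euclidean one throughout. *)
Lemma euclidean_le_norm (R : realType) (n : nat) (x : 'rV[R]_n) :
  euclidean_norm x <= n%:R * `|x|.
Proof.
rewrite -[leRHS]ger0_norm ?mulr_ge0// -sqrtr_sqr; apply: ler_wsqrtr.
apply: (@le_trans _ _ (\sum_(i < n) `|x| ^+ 2)).
  apply: ler_sum => i _; rewrite -[x ord0 i ^+ 2]real_normK ?num_real//.
  by rewrite lerXn2r ?nnegrE// ler_coord_norm.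
rewrite sumr_const card_ord -[leLHS]mulr_natl exprMn ler_wpM2r ?sqr_ge0//.
by case: n x => [|n] x; [rewrite expr0n|rewrite -natrX ler_nat leq_pmulr].
Qed.

Lemma for_continuousD (R : realType) (T : topologicalType) (f g : T -> R) (x : T) :
  {for x, continuous f} -> {for x, continuous g} ->
  {for x, continuous (fun y => f y + g y)}.
Proof. by move=> cf cg; exact: (continuousD cf cg). Qed.

Lemma for_continuousB (R : realType) (T : topologicalType) (f g : T -> R) (x : T) :
  {for x, continuous f} -> {for x, continuous g} ->
  {for x, continuous (fun y => f y - g y)}.
Proof. by move=> cf cg; exact: (continuousB cf cg). Qed.

Lemma for_continuousM (R : realType) (T : topologicalType) (f g : T -> R) (x : T) :
  {for x, continuous f} -> {for x, continuous g} ->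
  {for x, continuous (fun y => f y * g y)}.
Proof. by move=> cf cg; exact: (continuousM cf cg). Qed.

Lemma for_continuous_cst (R : realType) (T : topologicalType) (k : R) (x : T) :
  {for x, continuous (fun=> k)}.
Proof. exact: cst_continuous. Qed.

Lemma coord_cvg (R : realType) (n : nat) (x : 'rV[R]_n) (i : 'I_n) :
  y ord0 i @[y --> x] --> x ord0 i.
Proof. exact: (@coord_continuous R 1 n ord0 i x). Qed.

Lemma sqr_norm_continuous (R : realType) (n : nat) : continuous (@sqr_norm R n).
Proof.
move=> x; apply: (@cvg_sum_ord R _ (nbhs x) n (fun i y => y ord0 i ^+ 2)) => i.
by rewrite expr2; apply: cvgM; exact: coord_cvg.
Qed.

Lemma euclidean_norm_continuous (R : realType) (n : nat) :
  continuous (@euclidean_norm R n).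
Proof.
move=> x; apply: (@continuous_comp _ _ _ (@sqr_norm R n) Num.sqrt).
  exact: sqr_norm_continuous.
exact: sqrt_continuous.
Qed.

Lemma newton_continuous (R : realType) (n : nat) (x : 'rV[R]_n) :
  x != 0 -> {for x, continuous (@newton R n)}.
Proof.
move=> x0; apply: cvgV => /=.
- exact: (nbhs_filter x).
- by rewrite expf_neq0// gt_eqF// euclidean_norm_gt0.
- apply: (@continuous_comp _ _ _ (@euclidean_norm R n) (fun t => t ^+ (n - 2))).
    exact: euclidean_norm_continuous.
  exact: exprn_continuous.
Qed.

Lemma newton_gt0 (R : realType) (n : nat) (x : 'rV[R]_n) :
  x != 0 -> 0 < newton x.
Proof. by move=> x0; rewrite invr_gt0 exprn_gt0// euclidean_norm_gt0. Qed.

Lemma newton_le (R : realType) (n : nat) (x : 'rV[R]_n) (r : R) :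
  0 < r -> r <= euclidean_norm x -> newton x <= r ^- (n - 2).
Proof.
move=> r0 rx; rewrite lef_pV2 ?posrE ?exprn_gt0//; last exact: lt_le_trans rx.
by rewrite lerXn2r ?nnegrE ?euclidean_norm_ge0// ltW.
Qed.

Lemma newton_ge (R : realType) (n : nat) (x : 'rV[R]_n) (r : R) :
  x != 0 -> euclidean_norm x <= r -> r ^- (n - 2) <= newton x.
Proof.
move=> /euclidean_norm_gt0 x0 rx.
rewrite lef_pV2 ?posrE ?exprn_gt0//; last exact: lt_le_trans rx.
by rewrite lerXn2r ?nnegrE ?euclidean_norm_ge0// (le_trans _ rx)// ltW.
Qed.

Lemma closed_le_cst (R : realType) (T : topologicalType) (f : T -> R) (a : R) :
  continuous f -> closed [set x | f x <= a].
Proof.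
move=> cf; apply: (@closed_comp _ _ f [set t | t <= a]); last exact: closed_le.
by move=> x _; exact: cf.
Qed.

Lemma closed_ge_cst (R : realType) (T : topologicalType) (f : T -> R) (a : R) :
  continuous f -> closed [set x | a <= f x].
Proof.
move=> cf; apply: (@closed_comp _ _ f [set t | a <= t]); last exact: closed_ge.
by move=> x _; exact: cf.
Qed.

Lemma near_lt_cst (R : realType) (T : topologicalType) (f : T -> R) (x : T) (a : R) :
  {for x, continuous f} -> f x < a -> \forall y \near x, f y <= a.
Proof.
move=> cf fa; near=> y; apply: ltW; near: y.
by apply: (cvgr_lt _ cf).
Unshelve. all: by end_near. Qed.

Lemma near_gt_cst (R : realType) (T : topologicalType) (f : T -> R) (x : T) (a : R) :
  {for x, continuous f} -> a < f x -> \forall y \near x, a <= f y.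
Proof.
move=> cf fa; near=> y; apply: ltW; near: y.
by apply: (cvgr_gt _ cf).
Unshelve. all: by end_near. Qed.

Lemma shift_continuous (R : realType) (n : nat) (c : 'rV[R]_n) (f : 'rV[R]_n -> R)
    (x : 'rV[R]_n) :
  {for x - c, continuous f} -> {for x, continuous (fun y : 'rV[R]_n => f (y - c))}.
Proof.
move=> cf; apply: (@continuous_comp _ _ _ (fun y : 'rV[R]_n => y - c) f) => //.
by apply: (@continuousB R 'rV[R]_n _ id (fun=> c) x); [move=> ? ?|exact: cst_continuous].
Qed.

Lemma euclidean_dist_continuous (R : realType) (n : nat) (c : 'rV[R]_n) :
  continuous (fun y : 'rV[R]_n => euclidean_norm (y - c)).
Proof. by move=> x; apply: shift_continuous; exact: euclidean_norm_continuous. Qed.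

Lemma norm_dist_continuous (R : realType) (n : nat) (c : 'rV[R]_n) :
  continuous (fun y : 'rV[R]_n => `|y - c|).
Proof.
move=> x; apply: (@shift_continuous R n c (fun y : 'rV[R]_n => `|y|)).
exact: norm_continuous.
Qed.

Lemma closed_norm_bounded_compact (R : realType) (n : nat) (K : set 'rV[R]_n)
    (M : R) :
  closed K -> (forall x, K x -> `|x| <= M) -> compact K.
Proof.
move=> cK KM; apply: bounded_closed_compact => //.
exists M; split; first exact: num_real.
by move=> N /ltW MN x /KM xM; exact: le_trans MN.
Qed.

Lemma euclidean_ball_compact (R : realType) (n : nat) (c : 'rV[R]_n) (b : R) :
  compact [set x | euclidean_norm (x - c) <= b].
Proof.
apply: (@closed_norm_bounded_compact _ _ _ (b + `|c|)).
  exact: closed_le_cst (@euclidean_dist_continuous R n c).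
move=> x /= xb; rewrite -(subrK c x); apply: le_trans (ler_normD _ _) _.
by rewrite lerD2r; apply: le_trans xb; exact: norm_le_euclidean.
Qed.

Lemma cube_compact (R : realType) (n : nat) (c : 'rV[R]_n) (b : R) :
  compact [set x : 'rV[R]_n | `|x - c| <= b].
Proof.
apply: (@closed_norm_bounded_compact _ _ _ (b + `|c|)).
  exact: closed_le_cst (@norm_dist_continuous R n c).
move=> x /= xb; rewrite -{1}(subrK c x); apply: le_trans (ler_normD _ _) _.
by rewrite lerD2r.
Qed.

Lemma euclidean_norm_delta (R : realType) (n : nat) (i : 'I_n) (t : R) :
  0 <= t -> euclidean_norm (t *: delta_mx ord0 i : 'rV[R]_n) = t.
Proof.
move=> t0; have := sqr_norm_line (0 : 'rV[R]_n) i t.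
rewrite /euclidean_norm -/(sqr_norm _) add0r => ->.
rewrite /sqr_norm big1 => [|j _]; last by rewrite mxE expr0n.
by rewrite mxE mulr0 !add0r sqrtr_sqr ger0_norm.
Qed.

(** * Minimum principles *)

Definition superharmonic_at (R : realType) (n : nat) (w : 'rV[R]_n -> R)
    (x : 'rV[R]_n) : Prop :=
  exists2 L, L <= 0 & has_laplacian w x L.

(** Adding e (B - |x|^2), with B the maximum of |x|^2 on K, makes the Laplacian
    strictly negative, hence excludes an interior negative minimum; e is chosen
    so small that a negative value at x survives. *)
Lemma min_principle (R : realType) (n : nat) (K : set 'rV[R]_n)
    (w : 'rV[R]_n -> R) :
  (0 < n)%N -> compact K -> (forall x, K x -> {for x, continuous w}) ->
  (forall x, K x -> 0 <= w x \/ nbhs x K /\ superharmonic_at w x) ->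
  forall x, K x -> 0 <= w x.
Proof.
move=> n0 cK cw H x Kx; rewrite leNgt; apply/negP => wx.
have K0 : K !=set0 by exists x.
have [b _ bmax] : exists2 c, c \in K & forall t, t \in K -> sqr_norm t <= sqr_norm c.
  by apply: EVT_max_rV => //; apply: continuous_subspaceT; exact: sqr_norm_continuous.
set B := sqr_norm b in bmax; have B0 : 0 <= B by exact: sqr_norm_ge0.
pose e := - w x / (2 * (B + 1)).
have e0 : 0 < e by rewrite divr_gt0 ?oppr_gt0// mulr_gt0//; lra.
pose we y := w y + e * (B - sqr_norm y).
have cwe y : K y -> {for y, continuous we}.
  move=> Ky; apply: (for_continuousD (cw y Ky)).
  apply: for_continuousM; first exact: for_continuous_cst.
  apply: for_continuousB; first exact: for_continuous_cst.
  exact: sqr_norm_continuous.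
have [c cK' cmin] : exists2 c, c \in K & forall t, t \in K -> we c <= we t.
  apply: EVT_min_rV => //; apply: continuous_in_subspaceT => y /set_mem Ky.
  exact: (cwe y Ky).
have Kc := set_mem cK'.
have wex : we x < 0.
  have eB : e * (B + 1) = - w x / 2 by rewrite /e; field; lra.
  have := mulr_ge0 (ltW e0) (sqr_norm_ge0 x).
  by rewrite /we mulrBr mulrDr mulr1 in eB *; lra.
have wec : we c < 0 by apply: le_lt_trans wex; apply: cmin; exact: mem_set.
have [wc|[nK [L L0 wL]]] := H c Kc.
  have : 0 <= e * (B - sqr_norm c) by rewrite mulr_ge0 ?subr_ge0 ?bmax// ltW.
  by move: wec; rewrite /we; lra.
have : has_laplacian we c (L + e * (0 - 2 * n%:R)).
  apply: has_laplacianD => //; apply: has_laplacianZ.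
  by apply: has_laplacianB; [exact: has_laplacian_cst|exact: has_laplacian_sqr_norm].
move=> /has_laplacian_local_min/(_ (filterS _ nK)) Lge.
have : 0 <= L + e * (0 - 2 * n%:R).
  by apply: Lge => y Ky; apply: cmin; exact: mem_set.
have : 0 < e * n%:R by rewrite mulr_gt0// ltr0n.
by lra.
Qed.

(** The origin has zero capacity: e * newton is harmonic and exceeds any bound B
    near 0, so the minimum principle applies to w + e * newton outside a small
    ball around 0, and e is arbitrary. *)
Lemma punctured_min_principle (R : realType) (n : nat) (K : set 'rV[R]_n)
    (w : 'rV[R]_n -> R) (B : R) :
  (2 < n)%N -> compact K ->
  (forall x, K x -> x != 0 -> {for x, continuous w}) ->
  (forall x, K x -> x != 0 -> 0 <= w x \/ nbhs x K /\ superharmonic_at w x) ->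
  (forall x, K x -> x != 0 -> - B <= w x) ->
  forall x, K x -> x != 0 -> 0 <= w x.
Proof.
move=> n2 cK cw H Bw x Kx x0.
suff main e : 0 < e -> 0 <= w x + e * newton x.
  rewrite leNgt; apply/negP => wx.
  have := main (- w x / (2 * newton x)).
  rewrite divr_gt0 ?oppr_gt0 ?mulr_gt0 ?newton_gt0// => /(_ isT).
  suff -> : - w x / (2 * newton x) * newton x = - w x / 2 by lra.
  by field; rewrite gt_eqF ?newton_gt0.
move=> e0.
have B1 : 0 < `|B| + 1 by rewrite ltr_wpDl.
(* Below radius k the kernel term outweighs B. *)
pose k := Num.min (euclidean_norm x) (Num.min 1 (e / (`|B| + 1))).
have k0 : 0 < k by rewrite !lt_min euclidean_norm_gt0// ltr01 divr_gt0.
have k1 : k <= 1 by rewrite !ge_min lexx orbT.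
have kx : k <= euclidean_norm x by rewrite !ge_min lexx.
have ke : k * (`|B| + 1) <= e.
  by rewrite -ler_pdivlMr// !ge_min lexx !orbT.
have kB : B <= e * k ^- (n - 2).
  rewrite ler_pdivlMr ?exprn_gt0//; apply: le_trans ke.
  rewrite mulrC; apply: (@le_trans _ _ (k ^+ (n - 2) * (`|B| + 1))).
    by rewrite ler_pM2l ?exprn_gt0//; have := ler_norm B; lra.
  rewrite ler_pM2r// -{2}(expr1 k); apply: ler_wiXn2l => //; first exact: ltW.
  by rewrite subn_gt0.
apply: (@min_principle _ _ (K `&` [set y | k <= euclidean_norm y])
  (fun y => w y + e * newton y)) => //.
- exact: leq_trans n2.
- apply: compact_closedI => //.
  apply: (@closed_comp _ _ (@euclidean_norm R n) [set t | k <= t]).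
    by move=> y _; exact: euclidean_norm_continuous.
  exact: closed_ge.
- move=> y [Ky ky].
  have y0 : y != 0 by apply: euclidean_norm_gt0_neq0; exact: lt_le_trans ky.
  apply: (for_continuousD (cw y Ky y0)).
  by apply: for_continuousM; [exact: for_continuous_cst|exact: newton_continuous].
- move=> y [Ky ky].
  have y0 : y != 0 by apply: euclidean_norm_gt0_neq0; exact: lt_le_trans ky.
  move: ky; rewrite /= le_eqVlt => /orP[/eqP ky|ky].
    by left; move: kB; rewrite {1}ky => kB; have := Bw _ Ky y0; rewrite /newton; lra.
  have [wy|[nK [L L0 wL]]] := H y Ky y0.
    by left; rewrite addr_ge0// mulr_ge0// ltW// newton_gt0.
  right; split.
    apply: filterI => //.
    near=> z; apply: ltW; near: z.
    by apply: (cvgr_gt _ (@euclidean_norm_continuous R n y)).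
  exists (L + e * 0); first by rewrite mulr0 addr0.
  apply: has_laplacianD => //; apply: has_laplacianZ; apply: newton_harmonic => //.
  exact: ltnW.
Unshelve. all: by end_near. Qed.

(** * Positive superharmonic functions near a puncture *)

Definition punctured_ball (R : realType) (n : nat) (r : R) : set 'rV[R]_n :=
  [set x | x != 0 /\ euclidean_norm x <= r].

Definition superharmonic_on (R : realType) (n : nat) (A : set 'rV[R]_n)
    (w : 'rV[R]_n -> R) : Prop :=
  forall x, A x -> {for x, continuous w} /\ superharmonic_at w x.

Lemma superharmonic_sub_newton (R : realType) (n : nat) (w : 'rV[R]_n -> R)
    (b k : R) (c x : 'rV[R]_n) :
  (2 <= n)%N -> x != c ->
  {for x, continuous w} /\ superharmonic_at w x ->
  {for x, continuous (fun y : 'rV[R]_n => w y - b * (newton (y - c) - k))} /\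
  superharmonic_at (fun y : 'rV[R]_n => w y - b * (newton (y - c) - k)) x.
Proof.
move=> n2 xc [cw [L L0 wL]]; have xc0 : x - c != 0 by rewrite subr_eq0.
split.
  apply: (for_continuousB cw); apply: for_continuousM; first exact: for_continuous_cst.
  apply: for_continuousB; last exact: for_continuous_cst.
  by apply: shift_continuous; exact: newton_continuous.
exists (L - b * (0 - 0)); first by rewrite subr0 mulr0 subr0.
apply: has_laplacianB => //; apply: has_laplacianZ.
apply: has_laplacianB; last exact: has_laplacian_cst.
by apply: has_laplacian_shift; exact: newton_harmonic.
Qed.

Lemma superharmonic_sub_newton0 (R : realType) (n : nat) (w : 'rV[R]_n -> R)
    (b k : R) (x : 'rV[R]_n) :
  (2 <= n)%N -> x != 0 ->
  {for x, continuous w} /\ superharmonic_at w x ->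
  {for x, continuous (fun y : 'rV[R]_n => w y - b * (newton y - k))} /\
  superharmonic_at (fun y : 'rV[R]_n => w y - b * (newton y - k)) x.
Proof.
move=> n2 x0 wx; have := superharmonic_sub_newton b k n2 x0 wx.
rewrite (_ : (fun y : 'rV[R]_n => w y - b * (newton (y - 0) - k)) =
  (fun y : 'rV[R]_n => w y - b * (newton y - k)))//.
by apply/funext => y; rewrite subr0.
Qed.

(** The growth condition controls the nonlinearities at infinity only, and they
    may blow up at 0.  This bound keeps their arguments away from 0. *)
Lemma superharmonic_lower_bound (R : realType) (n : nat) (r0 : R)
    (u : 'rV[R]_n -> R) :
  (2 < n)%N -> 0 < r0 -> superharmonic_on (punctured_ball r0) u ->
  (forall x, punctured_ball r0 x -> 0 < u x) ->
  exists2 c, 0 < c & forall x, punctured_ball r0 x -> c <= u x.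
Proof.
move=> n2 r00 su u0; have n0 : (0 < n)%N by exact: leq_trans n2.
pose S := [set x : 'rV[R]_n | euclidean_norm x <= r0] `&`
  [set x : 'rV[R]_n | r0 <= euclidean_norm x].
have SP x : S x -> punctured_ball r0 x.
  by move=> [? rx]; split => //; apply: euclidean_norm_gt0_neq0; exact: lt_le_trans rx.
have compB : compact [set x : 'rV[R]_n | euclidean_norm x <= r0].
  have := @euclidean_ball_compact R n 0 r0.
  by under eq_set do rewrite subr0.
have [c /set_mem Sc cmin] : exists2 c, c \in S & forall t, t \in S -> u c <= u t.
  apply: EVT_min_rV.
  - exists (r0 *: delta_mx ord0 (Ordinal n0)).
    by split; rewrite /= euclidean_norm_delta// ltW.
  - apply: compact_closedI => //.
    exact: closed_ge_cst (@euclidean_norm_continuous R n).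
  - apply: continuous_in_subspaceT => y /set_mem /SP Py.
    by have [+ _] := su y Py; exact.
exists (u c); first exact/u0/SP.
move=> x [x0 xr]; rewrite -subr_ge0.
apply: (@punctured_min_principle R n [set x | euclidean_norm x <= r0]
  (fun y => u y - u c) (u c)) => //.
- move=> y yr y0; have [cu _] := su y (conj y0 yr).
  exact: (for_continuousB cu (@for_continuous_cst _ _ _ _)).
- move=> y yr y0; have [cu [L L0 uL]] := su y (conj y0 yr).
  move: (yr); rewrite /= le_eqVlt => /orP[/eqP yE|yl].
    by left; rewrite subr_ge0; apply: cmin; apply: mem_set; split; rewrite /= yE.
  right; split; first exact: near_lt_cst (@euclidean_norm_continuous R n y) yl.
  exists (L - 0); first by rewrite subr0.
  by apply: has_laplacianB => //; exact: has_laplacian_cst.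
- by move=> y yr y0; have := u0 y (conj y0 yr); lra.
Qed.

(** Up to normalisation, a is the mass that the singularity puts at the origin.
    It is obtained as the supremum of the b with b (newton - r0^-(n-2)) <= u.  If
    u - a (newton - r0^-(n-2)) exceeded e r^-(n-2) on spheres of arbitrarily
    small radius r, comparison on the annuli outside them would make a + e
    admissible. *)
Lemma newton_coefficient (R : realType) (n : nat) (r0 : R) (u : 'rV[R]_n -> R) :
  (2 < n)%N -> 0 < r0 -> superharmonic_on (punctured_ball r0) u ->
  (forall x, punctured_ball r0 x -> 0 < u x) ->
  exists2 a, 0 <= a &
    (forall x, punctured_ball r0 x ->
       0 <= u x - a * (newton x - r0 ^- (n - 2))) /\
    (forall e, 0 < e -> exists2 r1, 0 < r1 &
       forall r, 0 < r < r1 -> exists2 z : 'rV[R]_n, euclidean_norm z = r &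
         u z - a * (newton z - r0 ^- (n - 2)) <= e * r ^- (n - 2)).
Proof.
move=> n2 r00 su u0; have n0 : (0 < n)%N by exact: leq_trans n2.
set t0 := r0 ^- (n - 2).
pose S := [set b | 0 <= b /\
  forall x, punctured_ball r0 x -> b * (newton x - t0) <= u x].
have newt0 (x : 'rV[R]_n) : punctured_ball r0 x -> t0 <= newton x.
  by move=> [x0 xr]; exact: newton_ge.
have ubS x : punctured_ball r0 x -> t0 < newton x ->
    ubound S (u x / (newton x - t0)).
  by move=> Px tx b [_ /(_ x Px)]; rewrite ler_pdivlMr ?subr_gt0.
have S0 : S 0 by split => // x /u0 /ltW; rewrite mul0r.
have hS : has_sup S.
  split; first by exists 0.
  pose x : 'rV[R]_n := (r0 / 2) *: delta_mx ord0 (Ordinal n0).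
  have xE : euclidean_norm x = r0 / 2 by rewrite euclidean_norm_delta//; lra.
  exists (u x / (newton x - t0)); apply: ubS.
    by split; rewrite ?xE; [apply: euclidean_norm_gt0_neq0; rewrite xE|]; lra.
  rewrite /newton xE ltf_pV2 ?posrE ?exprn_gt0//; last by lra.
  have m0 : (n - 2 != 0)%N by rewrite -lt0n subn_gt0.
  rewrite ltrXn2r ?nnegrE ?m0//; lra.
have a0 : 0 <= sup S by exact: (sup_upper_bound hS).
exists (sup S) => //; split.
  move=> x Px; rewrite subr_ge0.
  have := newt0 x Px; rewrite le_eqVlt => /orP[/eqP <-|tx].
    by rewrite subrr mulr0 ltW// u0.
  rewrite -ler_pdivlMr ?subr_gt0//; apply: ge_sup; first by exists 0.
  exact: ubS.
move=> e e0; apply: contrapT => H.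
suff : S (sup S + e) by move=> /(sup_upper_bound hS); lra.
split; first by rewrite addr_ge0// ltW.
move=> x [x0 xr].
have [r [/andP[rgt0 rx] Hr]] : exists r, (0 < r < euclidean_norm x) /\
    forall z : 'rV[R]_n, euclidean_norm z = r ->
      e * r ^- (n - 2) < u z - sup S * (newton z - t0).
  apply: contrapT => H'; apply: H; exists (euclidean_norm x).
    exact: euclidean_norm_gt0.
  move=> r rx; apply: contrapT => H''; apply: H'; exists r; split => // z zr.
  by rewrite ltNge; apply/negP => zle; apply: H''; exists z.
have compB : compact [set x : 'rV[R]_n | euclidean_norm x <= r0].
  have := @euclidean_ball_compact R n 0 r0.
  by under eq_set do rewrite subr0.
rewrite -subr_ge0.
have Kneq0 (y : 'rV[R]_n) : r <= euclidean_norm y -> y != 0.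
  by move=> ry; apply: euclidean_norm_gt0_neq0; exact: lt_le_trans ry.
apply: (@min_principle R n ([set x | euclidean_norm x <= r0] `&`
    [set x | r <= euclidean_norm x])
  (fun y => u y - (sup S + e) * (newton y - t0))) => //.
- apply: compact_closedI => //.
  exact: closed_ge_cst (@euclidean_norm_continuous R n).
- move=> y [yr ry]; have y0 := Kneq0 y ry.
  by have [] := superharmonic_sub_newton0 (sup S + e) t0 (ltnW n2) y0 (su y (conj y0 yr)).
- move=> y [yr ry]; have y0 := Kneq0 y ry.
  have [_ sy] := superharmonic_sub_newton0 (sup S + e) t0 (ltnW n2) y0 (su y (conj y0 yr)).
  move: (ry); rewrite /= le_eqVlt => /orP[/eqP rE|rl].
    left; have := Hr y (esym rE); rewrite {1}rE -/(newton y).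
    have : 0 <= e * t0 by rewrite mulr_ge0 ?ltW// invr_gt0 exprn_gt0.
    by lra.
  move: (yr); rewrite /= le_eqVlt => /orP[/eqP yE|yl].
    by left; rewrite /newton yE -/t0 subrr mulr0 subr0 ltW// u0.
  right; split=> //; apply: filterI.
    exact: near_lt_cst (@euclidean_norm_continuous R n y) yl.
  exact: near_gt_cst (@euclidean_norm_continuous R n y) rl.
- by split => //=; exact: ltW.
Qed.

(** * Oscillation of functions with bounded Laplacian *)

Definition mirror (R : realType) (n : nat) (i : 'I_n) (c x : 'rV[R]_n) : 'rV[R]_n :=
  x - (2 * (x ord0 i - c ord0 i)) *: delta_mx ord0 i.

Lemma mirrorE (R : realType) (n : nat) (i j : 'I_n) (c x : 'rV[R]_n) :
  mirror i c x ord0 j =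
  if j == i then 2 * c ord0 i - x ord0 i else x ord0 j.
Proof.
rewrite /mirror !mxE eqxx /=; case: eqP => [->|_] /=; ring.
Qed.

Lemma norm_mirror (R : realType) (n : nat) (i : 'I_n) (c x : 'rV[R]_n) (d : R) :
  `|x - c| <= d -> `|mirror i c x - c| <= d.
Proof.
move=> xd; apply: norm_le_coord => [|j]; first exact: le_trans xd.
have xj : `|x ord0 j - c ord0 j| <= d.
  by have := ler_coord_norm (x - c) j; rewrite !mxE => /le_trans; exact.
rewrite mxE mirrorE mxE; case: eqP => [ji|//]; subst j.
by rewrite (_ : _ - _ = - (x ord0 i - c ord0 i)) ?normrN//; ring.
Qed.

Lemma mirror_continuous (R : realType) (n : nat) (i : 'I_n) (c : 'rV[R]_n)
    (u : 'rV[R]_n -> R) (x : 'rV[R]_n) :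
  {for mirror i c x, continuous u} ->
  {for x, continuous (fun y : 'rV[R]_n => u (mirror i c y))}.
Proof.
move=> cu.
have cz : {for x, continuous (fun y : 'rV[R]_n => 2 * (y ord0 i - c ord0 i))}.
  apply: for_continuousM; first exact: for_continuous_cst.
  apply: for_continuousB; last exact: for_continuous_cst.
  exact: coord_continuous.
have cid : {for x, continuous (@id 'rV[R]_n)} by move=> ?.
have cr : {for x, continuous (@mirror R n i c)}.
  exact: (continuousB cid (continuousZr_tmp (a := delta_mx ord0 i) cz)).
exact: (@continuous_comp _ _ _ (@mirror R n i c) u x cr cu).
Qed.

Lemma has_laplacian_mirror (R : realType) (n : nat) (i : 'I_n) (c : 'rV[R]_n)
    (u : 'rV[R]_n -> R) (x : 'rV[R]_n) (L : R) :
  has_laplacian u (mirror i c x) L ->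
  has_laplacian (fun y : 'rV[R]_n => u (mirror i c y)) x L.
Proof.
rewrite /has_laplacian (_ : second_difference u (mirror i c x) =
  second_difference (fun y => u (mirror i c y)) x) //.
apply/funext => h; congr (_ / _); apply: eq_bigr => j _.
have [<-|ji] := eqVneq i j.
  rewrite (_ : mirror i c (x + h *: _) = mirror i c x - h *: delta_mx ord0 i).
    rewrite (_ : mirror i c (x - h *: _) = mirror i c x + h *: delta_mx ord0 i).
      by rewrite (addrC (u (mirror i c x + _))).
    by apply/rowP => k; rewrite !(mirrorE, mxE) !eqxx; case: eqP => _ /=; ring.
  by apply/rowP => k; rewrite !(mirrorE, mxE) !eqxx; case: eqP => _ /=; ring.
congr (u _ + u _ - _); apply/rowP => k; rewrite !(mirrorE, mxE) !eqxx;
  case: (eqVneq k i) => [->|_] /=; rewrite ?(negbTE ji) /=; ring.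
Qed.

Definition tame_on (R : realType) (n : nat) (Q : set 'rV[R]_n) (A K : R)
    (u : 'rV[R]_n -> R) : Prop :=
  forall x, Q x -> [/\ {for x, continuous u}, 0 <= u x <= A &
    exists2 L, - K <= L <= 0 & has_laplacian u x L].

Lemma tame_on_mirror (R : realType) (n : nat) (i : 'I_n) (c : 'rV[R]_n)
    (d A K : R) (u : 'rV[R]_n -> R) :
  tame_on [set x | `|x - c| <= d] A K u ->
  tame_on [set x | `|x - c| <= d] A K (fun x => u (mirror i c x)).
Proof.
move=> tu x xd; have [cu uA [L LK uL]] := tu _ (norm_mirror i xd).
split=> //; first exact: mirror_continuous.
by exists L => //; exact: has_laplacian_mirror.
Qed.

(** On the half cube z >= 0, where z is the i-th coordinate of x - c, the odd part
    u(x) - u(mirror x) vanishes on z = 0, is at most A, and has Laplacian at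
    least -K.  With b = A / d^2, the polynomial
    b (|x - c|^2 + n z (d - z)) + K/2 z (d - z) has Laplacian -K, is nonnegative
    on z = 0 and at least A on the rest of the boundary, so it dominates the odd
    part; on the axis it is O(z). *)
Lemma reflection_estimate (R : realType) (n : nat) (i : 'I_n) (c : 'rV[R]_n)
    (d A K y : R) (u : 'rV[R]_n -> R) :
  0 < d -> 0 <= A -> 0 <= K ->
  tame_on [set x | `|x - c| <= d] A K u -> 0 <= y <= d ->
  u (c + y *: delta_mx ord0 i) - u (c - y *: delta_mx ord0 i)
    <= y * (n%:R * A / d + K * d / 2).
Proof.
move=> d0 A0 K0 tu /andP[y0 yd].
have n0 : (0 < n)%N by exact: leq_ltn_trans (ltn_ord i).
have n1 : 1 <= n%:R :> R by rewrite ler1n.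
set z := fun x : 'rV[R]_n => (x - c) ord0 i.
have zE x : z x = x ord0 i - c ord0 i by rewrite /z !mxE.
have cz : continuous z.
  move=> x; apply: (@shift_continuous R n c (fun x => x ord0 i)).
  exact: coord_continuous.
set b := A / d ^+ 2.
have b0 : 0 <= b by rewrite divr_ge0// sqr_ge0.
have bd : b * d ^+ 2 = A by rewrite /b divfK// gt_eqF// exprn_gt0.
pose psi (x : 'rV[R]_n) := b * (sqr_norm (x - c) + n%:R * (d * z x - z x ^+ 2)) +
  K / 2 * (d * z x - z x ^+ 2).
pose w x := psi x - (u x - u (mirror i c x)).
pose D := [set x : 'rV[R]_n | `|x - c| <= d] `&` [set x | 0 <= z x].
have zd x : `|x - c| <= d -> z x <= d.
  by move=> xd; apply: le_trans xd; apply: le_trans (ler_coord_norm _ i); exact: ler_norm.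
have czz (x : 'rV[R]_n) : {for x, continuous (fun x => d * z x - z x ^+ 2)}.
  apply: for_continuousB.
    by apply: for_continuousM; [exact: for_continuous_cst|exact: cz].
  by apply: (@for_continuousM R _ z z); exact: cz.
have w0 x : D x -> 0 <= w x.
  apply: (@min_principle R n D w) => //.
  - apply: compact_closedI; first exact: cube_compact.
    exact: closed_ge_cst.
  - move=> {}x [/= xd _].
    have [cu _ _] := tu x xd; have [cru _ _] := tame_on_mirror i tu xd.
    apply: for_continuousB; last exact: for_continuousB.
    apply: for_continuousD; apply: for_continuousM.
    + exact: for_continuous_cst.
    + apply: for_continuousD.
        by apply: (@shift_continuous R n c (@sqr_norm R n)); exact: sqr_norm_continuous.
      by apply: for_continuousM; [exact: for_continuous_cst|exact: czz].
    + exact: for_continuous_cst.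
    + exact: czz.
  - move=> {}x [/= xd zx].
    have [_ /andP[u0 uA] [L1 /andP[L1K _] uL1]] := tu x xd.
    have [_ /andP[ru0 ruA] [L2 /andP[_ L20] uL2]] := tame_on_mirror i tu xd.
    have zxd := zd _ xd.
    have zz : 0 <= d * z x - z x ^+ 2.
      by rewrite expr2 -mulrBl mulr_ge0// subr_ge0.
    move: (xd); rewrite le_eqVlt => /orP[/eqP xE|xl].
      left.
      have : d ^+ 2 <= sqr_norm (x - c).
        rewrite sqr_normE lerXn2r ?nnegrE ?euclidean_norm_ge0//; first exact: ltW.
        by rewrite -{1}xE norm_le_euclidean.
      move=> /(ler_wpM2l b0); rewrite bd => Ab.
      have : 0 <= b * (n%:R * (d * z x - z x ^+ 2)) by rewrite mulr_ge0// mulr_ge0.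
      have : 0 <= K / 2 * (d * z x - z x ^+ 2) by rewrite mulr_ge0// divr_ge0.
      by rewrite /w /psi; lra.
    move: zx; rewrite le_eqVlt => /orP[/eqP zx0|zx].
      left; have -> : w x = b * sqr_norm (x - c).
        rewrite /w /psi -zx0 (_ : mirror i c x = x); first by ring.
        by rewrite /mirror -zE -zx0 mulr0 scale0r subr0.
      by rewrite mulr_ge0// sqr_norm_ge0.
    right; split.
      apply: filterI; first exact: near_lt_cst (@norm_dist_continuous R n c x) xl.
      exact: near_gt_cst (cz x) zx.
    have lzz : has_laplacian (fun x => d * z x - z x ^+ 2) x (d * 0 - 2).
      apply: (@has_laplacian_shift _ _ (fun x => d * x ord0 i - x ord0 i ^+ 2)).
      apply: has_laplacianB; last exact: has_laplacian_sqr_coord.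
      by apply: has_laplacianZ; exact: has_laplacian_coord.
    exists (b * (2 * n%:R + n%:R * (d * 0 - 2)) + K / 2 * (d * 0 - 2) - (L1 - L2)).
      by lra.
    apply: has_laplacianB; last exact: has_laplacianB.
    apply: has_laplacianD; apply: has_laplacianZ => //.
    apply: has_laplacianD; last exact: has_laplacianZ.
    by apply: has_laplacian_shift; exact: has_laplacian_sqr_norm.
set p := c + _; have zp : z p = y.
  by rewrite zE /p !mxE !eqxx /=; ring.
have pc : p - c = y *: delta_mx ord0 i by rewrite /p addrC addKr.
have : 0 <= w p.
  apply: w0; split; rewrite /= ?zp// pc.
  apply: norm_le_coord => [|j]; first exact: ltW.
  rewrite !mxE; case: (j == i); rewrite /= ?mulr1 ?mulr0.
    by rewrite ger0_norm.
  by rewrite normr0 ltW.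
rewrite /w /psi zp pc.
have -> : sqr_norm (y *: delta_mx ord0 i : 'rV[R]_n) = y ^+ 2.
  by rewrite sqr_normE euclidean_norm_delta.
have -> : mirror i c p = c - y *: delta_mx ord0 i.
  rewrite /mirror -zE zp /p -addrA -scalerBl; congr (c + _).
  by rewrite (_ : y - 2 * y = - y) ?scaleNr//; ring.
have -> : n%:R * A / d = b * (n%:R * d) by rewrite /b; field; rewrite gt_eqF.
have : 0 <= b * ((n%:R - 1) * y ^+ 2) 
  by rewrite mulr_ge0// mulr_ge0 ?sqr_ge0// subr_ge0.
have : 0 <= K * y ^+ 2 by rewrite mulr_ge0// sqr_ge0.
by lra.
Qed.

Lemma reflection_estimate_abs (R : realType) (n : nat) (i : 'I_n) (c : 'rV[R]_n)
    (d A K y : R) (u : 'rV[R]_n -> R) :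
  0 < d -> 0 <= A -> 0 <= K ->
  tame_on [set x | `|x - c| <= d] A K u -> `|y| <= d ->
  u (c - y *: delta_mx ord0 i) - u (c + y *: delta_mx ord0 i)
    <= `|y| * (n%:R * A / d + K * d / 2).
Proof.
move=> d0 A0 K0 tu yd.
have [y0|y0] := leP 0 y; last first.
  have := @reflection_estimate R n i c d A K (- y) u d0 A0 K0 tu.
  by rewrite ltr0_norm// in yd *; rewrite scaleNr opprK; apply; rewrite yd andbT; lra.
have := @reflection_estimate R n i c d A K y _ d0 A0 K0 (tame_on_mirror i tu).
rewrite ger0_norm// in yd *; rewrite yd y0 => /(_ isT).
rewrite (_ : mirror i c (c + y *: delta_mx ord0 i) = c - y *: delta_mx ord0 i).
  rewrite (_ : mirror i c (c - y *: delta_mx ord0 i) = c + y *: delta_mx ord0 i)//.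
  by apply/rowP => k; rewrite !(mirrorE, mxE) !eqxx; case: (eqVneq k i) => [->|_] /=; ring.
by apply/rowP => k; rewrite !(mirrorE, mxE) !eqxx; case: (eqVneq k i) => [->|_] /=; ring.
Qed.

(** The points x and q are joined by a path changing one coordinate at a time,
    and each step is controlled by a reflection about its midpoint. *)
Lemma oscillation_estimate (R : realType) (n : nat) (x q : 'rV[R]_n)
    (r A K theta : R) (u : 'rV[R]_n -> R) :
  0 < r -> 0 <= A -> 0 <= K -> 0 <= theta <= 1 / 2 ->
  tame_on [set y | `|y - x| <= r] A K u -> `|q - x| <= theta * r ->
  u x - u q <= n%:R * (theta * (n%:R * A + K * r ^+ 2 / 8)).
Proof.
move=> r0 A0 K0 /andP[th0 th1] tu qx.
set B := theta * _.
have thr : theta * r <= r / 2 by have := ler_wpM2r (ltW r0) th1; lra.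
have qxj j : `|q ord0 j - x ord0 j| <= theta * r.
  by have := ler_coord_norm (q - x) j; rewrite !mxE => /le_trans; exact.
pose p (k : nat) : 'rV[R]_n := \row_j if (j < k)%N then q ord0 j else x ord0 j.
have main k : (k <= n)%N -> u x - u (p k) <= k%:R * B.
  elim: k => [_|k IH kn].
    by rewrite mul0r (_ : p 0%N = x) ?subrr//; apply/rowP => j; rewrite mxE.
  have {IH} := IH (ltnW kn).
  pose i := Ordinal kn.
  pose y := (q ord0 i - x ord0 i) / 2.
  have yr : `|y| <= theta * r / 2.
    by rewrite normrM (ger0_norm (_ : 0 <= 2^-1)) ?invr_ge0// ler_pM2r// ?invr_gt0.
  pose c := p k + y *: delta_mx ord0 i.
  have p1 : p k = c - y *: delta_mx ord0 i by rewrite addrK.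
  have p2 : p k.+1 = c + y *: delta_mx ord0 i.
    apply/rowP => j; rewrite !mxE eqxx /= ltnS leq_eqVlt.
    have [->|ji] := eqVneq j i; first by rewrite eqxx ltnn /= /y; field.
    rewrite (_ : (j == k :> nat) = false) /=; last first.
      by apply: contraNF ji => /eqP jk; apply/eqP/val_inj.
    by rewrite mulr0 !addr0.
  have tc : tame_on [set z | `|z - c| <= r / 2] A K u.
    move=> z /= zc; apply: tu; rewrite /= -(subrK c z) -addrA.
    apply: le_trans (ler_normD _ _) _.
    suff : `|c - x| <= theta * r by lra.
    apply: norm_le_coord => [|j]; first by rewrite mulr_ge0// ltW.
    rewrite !mxE eqxx /=; have [->|ji] := eqVneq j i.
      rewrite ltnn /= mulr1 (_ : _ - _ = y); last by ring.
      by apply: le_trans yr _; have := mulr_ge0 th0 (ltW r0); lra.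
    rewrite /= mulr0 addr0; case: ifP => _; first exact: qxj.
    by rewrite subrr normr0 mulr_ge0// ltW.
  have := @reflection_estimate_abs R n i c (r / 2) A K y u.
  rewrite -p1 -p2 divr_gt0// => /(_ isT A0 K0 tc).
  have -> : `|y| <= r / 2 by apply: le_trans yr _; have := mulr_ge0 th0 (ltW r0); lra.
  move=> /(_ isT).
  suff : `|y| * (n%:R * A / (r / 2) + K * (r / 2) / 2) <= B.
    by rewrite -[k.+1%:R]natr1; lra.
  apply: (@le_trans _ _ (theta * r / 2 * (n%:R * A / (r / 2) + K * (r / 2) / 2))).
    apply: ler_wpM2r => //; apply: addr_ge0; first by rewrite !mulr_ge0// invr_ge0; lra.
    by rewrite !mulr_ge0// ?invr_ge0//; lra.
  by rewrite le_eqVlt /B; apply/orP; left; apply/eqP; field; rewrite gt_eqF.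
have := main n (leqnn n); rewrite (_ : p n = q)//.
by apply/rowP => j; rewrite mxE ltn_ord.
Qed.

(** * Absence of high peaks *)

Lemma expNM (R : realType) (x y : R) (m : nat) :
  (x * y) ^- m = x ^- m * y ^- m.
Proof. by rewrite exprMn invfM. Qed.

(** Comparison of w with b (|z - x1|^-(n-2) - l^-(n-2)).  The ball of radius l may
    contain the puncture, so the bound reaches points on all sides of the
    origin in one step, without a chain of balls. *)
Lemma punctured_barrier (R : realType) (n : nat) (w : 'rV[R]_n -> R)
    (x1 : 'rV[R]_n) (s l b : R) :
  (2 < n)%N -> 0 < s -> 0 <= b ->
  (forall y, y != 0 -> euclidean_norm (y - x1) <= l ->
    [/\ {for y, continuous w}, superharmonic_at w y & 0 <= w y]) ->
  (forall y, y != 0 -> euclidean_norm (y - x1) = s -> b * s ^- (n - 2) <= w y) ->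
  forall z, z != 0 -> s <= euclidean_norm (z - x1) <= l ->
  b * (newton (z - x1) - l ^- (n - 2)) <= w z.
Proof.
move=> n2 s0 b0 hw ws z z0 /andP[sz zl]; rewrite -subr_ge0.
have l0 : 0 < l by apply: lt_le_trans zl; exact: lt_le_trans sz.
have lN : 0 <= b * l ^- (n - 2) by rewrite mulr_ge0// invr_ge0 exprn_ge0 ?ltW.
have Kneq (y : 'rV[R]_n) : s <= euclidean_norm (y - x1) -> y != x1.
  by move=> sy; rewrite -subr_eq0; apply: euclidean_norm_gt0_neq0; exact: lt_le_trans sy.
apply: (@punctured_min_principle R n
  ([set y | euclidean_norm (y - x1) <= l] `&` [set y | s <= euclidean_norm (y - x1)])
  (fun y => w y - b * (newton (y - x1) - l ^- (n - 2))) (b * s ^- (n - 2))) => //.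
- apply: compact_closedI; first exact: euclidean_ball_compact.
  exact: closed_ge_cst (@euclidean_dist_continuous R n x1).
- move=> y [/= yl sy] y0; have [cw sw _] := hw y y0 yl.
  by have [] := superharmonic_sub_newton b (l ^- (n - 2)) (ltnW n2) (Kneq y sy) (conj cw sw).
- move=> y [/= yl sy] y0; have [cw sw wy] := hw y y0 yl.
  have [_ sh] := superharmonic_sub_newton b (l ^- (n - 2)) (ltnW n2) (Kneq y sy) (conj cw sw).
  move: (yl); rewrite le_eqVlt => /orP[/eqP yE|yl'].
    by left; rewrite /newton yE subrr mulr0 subr0.
  move: (sy); rewrite le_eqVlt => /orP[/eqP sE|sy'].
    by left; have := ws y y0 (esym sE); rewrite /newton -sE; lra.
  right; split => //; apply: filterI.
    exact: near_lt_cst (@euclidean_dist_continuous R n x1 y) yl'.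
  exact: near_gt_cst (@euclidean_dist_continuous R n x1 y) sy'.
- move=> y [/= yl sy] y0; have [_ _ wy] := hw y y0 yl.
  by have := ler_wpM2l b0 (newton_le s0 sy); lra.
Qed.

(** The peak value is written r^-(n-2), which makes r the natural length: rescaled
    by r, the peak has height 1 and the bounds in [tame_on] do not depend on
    r.  Here rho is the distance scale of x1 to the origin. *)
Definition no_peak (R : realType) (n : nat) (C rho0 k : R) (u : 'rV[R]_n -> R) :
    Prop :=
  forall (x1 : 'rV[R]_n) (rho r : R), 0 < rho < rho0 ->
    rho / (2 * n%:R) <= `|x1| -> `|x1| <= 2 * rho ->
    0 < r <= rho / (4 * n%:R) -> C * rho ^- (n - 2) <= r ^- (n - 2) ->
    u x1 = r ^- (n - 2) ->
    tame_on [set y | `|y - x1| <= r] (2 ^+ (n - 2) * r ^- (n - 2))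
      (k * r ^- n) u ->
    False.

Lemma no_peakW (R : realType) (n : nat) (C C' rho0 rho0' k : R)
    (u : 'rV[R]_n -> R) :
  C <= C' -> rho0' <= rho0 -> no_peak C rho0 k u -> no_peak C' rho0' k u.
Proof.
move=> CC rr np x1 rho r /andP[rho_gt0 rho_lt] h1 h2 h3 h4.
apply: (np x1 rho r) => //; first by rewrite rho_gt0 (lt_le_trans rho_lt).
by apply: le_trans h4; rewrite ler_wpM2r// invr_ge0 exprn_ge0// ltW.
Qed.

(** A high peak forces u >= r^-m / 2 on a ball of radius th * r, where m = n - 2.
    The remainder w = u - a (newton - r0^-m) is then at least r^-m / 4 there, and
    the barrier with constant b = (th r)^m r^-m / 4 = th^m / 4 gives a multiple
    of rho^-m as a lower bound for w on the whole sphere of radius rho, against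
    the smallness of w at some point of that sphere. *)
Lemma no_high_peak (R : realType) (n : nat) (r0 a k : R) (u : 'rV[R]_n -> R) :
  (2 < n)%N -> 0 < r0 -> 0 <= a -> 0 <= k ->
  superharmonic_on (punctured_ball r0) u ->
  (forall x, punctured_ball r0 x ->
       0 <= u x - a * (newton x - r0 ^- (n - 2))) ->
  (forall e, 0 < e -> exists2 r1, 0 < r1 &
       forall r, 0 < r < r1 -> exists2 z : 'rV[R]_n, euclidean_norm z = r &
         u z - a * (newton z - r0 ^- (n - 2)) <= e * r ^- (n - 2)) ->
  exists2 C, 0 < C & exists2 rho0, 0 < rho0 & no_peak C rho0 k u.
Proof.
move=> n2 r00 a0 k0 su ua uz; set m := (n - 2)%N.
have nm : n = (m + 2)%N by rewrite /m subnK// ltnW.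
set N : R := n%:R.
have N0 : 0 < N by rewrite ltr0n (leq_trans _ n2).
have N00 := ltW N0.
have N1 : 1 <= N by rewrite ler1n (leq_trans _ n2).
(* r^-m * th * X bounds the oscillation of u at distance th * r from x1. *)
pose X := N * (N * 2 ^+ m + k / 8).
have X0 : 0 <= X.
  by rewrite mulr_ge0// addr_ge0 ?divr_ge0// mulr_ge0// exprn_ge0.
pose th := (2 * X + 2)^-1.
have th0 : 0 < th by rewrite invr_gt0; lra.
have th00 := ltW th0.
have thX : th * (2 * X + 2) = 1 by rewrite mulVf// gt_eqF//; lra.
have thX0 : 0 <= th * X by rewrite mulr_ge0.
have th1 : th <= 1 / 2 by lra.
pose b := th ^+ m / 4.
have b0 : 0 < b by rewrite divr_gt0// exprn_gt0.
have N3 : 0 < (3 * N) ^- m by rewrite invr_gt0 exprn_gt0// mulr_gt0.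
(* The sphere of radius rho stays within 3 * N * rho of x1, and the barrier
   vanishes at distance 6 * N * rho; e is half of the bound that this yields. *)
pose e := b * (3 * N) ^- m / 4.
have e0 : 0 < e by rewrite divr_gt0// mulr_gt0.
have e1 : e < 1.
  have : b * (3 * N) ^- m <= 1.
    apply: mulr_ile1; [exact: ltW|exact: ltW| |].
      have : th ^+ m <= 1 by apply: exprn_ile1; lra.
      by rewrite /b; lra.
    by rewrite invf_le1 ?exprn_gt0 ?mulr_gt0// exprn_ege1//; lra.
  by rewrite /e; lra.
(* With this C the term a * newton is at most r^-m / 4 near x1. *)
pose C := 4 * a * (4 * N) ^+ m + 4.
have C4 : 4 <= C.
  by rewrite lerDr mulr_ge0 ?mulr_ge0// exprn_ge0// mulr_ge0.
exists C; first by lra.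
have [r1 r10 Hr1] := uz e e0.
have N8 : 0 < 8 * N ^+ 2 by rewrite mulr_gt0// exprn_gt0.
exists (Num.min r1 (r0 / (8 * N ^+ 2))); first by rewrite lt_min r10 divr_gt0.
move=> x1 rho r /andP[rho0]; rewrite lt_min => /andP[rho1].
rewrite ltr_pdivlMr// => rho8 x1ge x1le /andP[rp rN] Cr ux1 tu.
have rp0 := ltW rp; have rho00 := ltW rho0.
have [z zrho uzz] : exists2 z : 'rV[R]_n, euclidean_norm z = rho &
         u z - a * (newton z - r0 ^- m) <= e * rho ^- m.
  by apply: Hr1; rewrite rho0.
have z0 : z != 0 by apply: euclidean_norm_gt0_neq0; rewrite zrho.
have rm0 : 0 < r ^- m by rewrite invr_gt0 exprn_gt0.
have rhom0 : 0 < rho ^- m by rewrite invr_gt0 exprn_gt0.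
pose w (y : 'rV[R]_n) := u y - a * (newton y - r0 ^- m).
have P x : x != 0 -> euclidean_norm (x - x1) <= 6 * N * rho -> punctured_ball r0 x.
  move=> x0 xx; split=> //; apply: le_trans (euclidean_le_norm x) _.
  have : `|x| <= 6 * N * rho + 2 * rho.
    rewrite -{1}(subrK x1 x); apply: le_trans (ler_normD _ _) _.
    by apply: lerD => //; apply: le_trans xx; exact: norm_le_euclidean.
  move=> /(ler_wpM2l (ltW N0)) /le_trans; apply; apply: ltW; apply: le_lt_trans rho8.
  have : 0 <= rho * (N * (N - 1)) by rewrite mulr_ge0// mulr_ge0// subr_ge0.
  by rewrite -/N; lra.
have hw y : y != 0 -> euclidean_norm (y - x1) <= 6 * N * rho ->
    [/\ {for y, continuous w}, superharmonic_at w y & 0 <= w y].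
  move=> y0 yl; have Py := P y y0 yl.
  have [cw sw] := superharmonic_sub_newton0 a (r0 ^- m) (ltnW n2) y0 (su y Py).
  by split => //; exact: ua.
have near_peak q : q != 0 -> `|q - x1| <= th * r -> r ^- m / 4 <= w q.
  move=> q0 qx.
  have thr : th * r <= r / 2 by have := ler_wpM2r (ltW rp) th1; lra.
  have uq : r ^- m / 2 <= u q.
    have A0 : 0 <= 2 ^+ m * r ^- m by rewrite mulr_ge0 ?exprn_ge0// ltW.
    have K0 : 0 <= k * r ^- n by rewrite mulr_ge0// invr_ge0 exprn_ge0.
    have th01 : 0 <= th <= 1 / 2 by rewrite ltW.
    have := oscillation_estimate rp A0 K0 th01 tu qx.
    have -> : k * r ^- n * r ^+ 2 = k * r ^- m.
      by rewrite {1}nm exprD; field; rewrite !expf_neq0// gt_eqF.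
    rewrite ux1 -/N -/m.
    have -> : N * (th * (N * (2 ^+ m * r ^- m) + k * r ^- m / 8)) = th * X * r ^- m.
      by rewrite /X; ring.
    have : th * X * r ^- m <= 1 / 2 * r ^- m by rewrite ler_wpM2r ?ltW//; lra.
    by lra.
  have qge : rho / (4 * N) <= euclidean_norm q.
    apply: le_trans (norm_le_euclidean q).
    have : `|x1| <= `|q| + `|q - x1|.
      by rewrite -{1}(subrK q x1) addrC; apply: le_trans (ler_normD _ _) _; rewrite distrC.
    have : rho / (2 * N) = 2 * (rho / (4 * N)) by field; rewrite gt_eqF.
    by move: x1ge; rewrite -/N; lra.
  have N4 : 0 < rho / (4 * N) by rewrite divr_gt0// mulr_gt0.
  have := newton_le N4 qge.
  rewrite -/m expNM exprVn invrK => /(ler_wpM2l a0).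
  have aR : 0 <= a * r0 ^- m by rewrite mulr_ge0// invr_ge0 exprn_ge0// ltW.
  move: Cr; rewrite /C -/m /w; lra.
have s0 : 0 < th * r by rewrite mulr_gt0.
have bs : b * (th * r) ^- m = r ^- m / 4.
  by rewrite expNM /b; field; rewrite !expf_neq0 ?gt_eqF.
have zl : euclidean_norm (z - x1) <= 3 * N * rho.
  apply: le_trans (euclidean_le_norm _) _; rewrite -/N.
  have : `|z - x1| <= 3 * rho.
    apply: le_trans (ler_normB z x1) _.
    by have := norm_le_euclidean z; rewrite zrho; lra.
  by move=> /(ler_wpM2l (ltW N0)) /le_trans; apply; lra.
have wz : w z <= e * rho ^- m by [].
have [zs|sz] := leP (euclidean_norm (z - x1)) (th * r).
  have : r ^- m / 4 <= w z.
    by apply: near_peak => //; apply: le_trans zs; exact: norm_le_euclidean.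
  have : e * rho ^- m < 1 * rho ^- m by rewrite ltr_pM2r.
  have : 4 * rho ^- m <= C * rho ^- m by rewrite ler_pM2r.
  by move: Cr; rewrite -/m; lra.
have wb : b * (newton (z - x1) - (6 * N * rho) ^- m) <= w z.
  apply: (@punctured_barrier R n w x1 (th * r)) => //; first exact: ltW.
    by move=> y y0 yE; rewrite -/m bs; apply: near_peak => //; rewrite -yE norm_le_euclidean.
  have Nrho : 0 <= N * rho by rewrite mulr_ge0.
  by apply/andP; split; [exact: ltW|apply: le_trans zl _; lra].
have zx1 : z != x1.
  by rewrite -subr_eq0; apply: euclidean_norm_gt0_neq0; exact: lt_trans sz.
have : (3 * N * rho) ^- m <= newton (z - x1).
  by apply: newton_ge => //; rewrite subr_eq0.
have : (6 * N * rho) ^- m <= (3 * N * rho) ^- m / 2.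
  have -> : 6 * N * rho = 2 * (3 * N * rho) by ring.
  rewrite expNM mulrC ler_pM2l; last by rewrite invr_gt0 exprn_gt0// !mulr_gt0.
  rewrite lef_pV2 ?posrE ?exprn_gt0// -{1}(expr1 2) ler_eXn2l ?subn_gt0//.
  by rewrite ltr1n.
rewrite (expNM (3 * N) rho) => h6 h3.
have : b * ((3 * N) ^- m * rho ^- m / 2) <= w z.
  by apply: le_trans wb; rewrite ler_pM2l//; lra.
have : 0 < b * ((3 * N) ^- m * rho ^- m) by rewrite mulr_gt0// mulr_gt0.
by move: wz; rewrite /e; lra.
Qed.

Lemma exists_no_peak (R : realType) (n : nat) (r0 k : R) (u : 'rV[R]_n -> R) :
  (2 < n)%N -> 0 < r0 -> 0 <= k ->
  superharmonic_on (punctured_ball r0) u ->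
  (forall x, punctured_ball r0 x -> 0 < u x) ->
  exists2 C, 0 < C & exists2 rho0, 0 < rho0 & no_peak C rho0 k u.
Proof.
move=> n2 r00 k0 su u0; have [a a0 [ua uz]] := newton_coefficient n2 r00 su u0.
exact: (no_high_peak n2 r00 a0 k0 su ua uz).
Qed.

(** * The nonlinearity at the critical scaling *)

(** For large t, f(t) is at most a multiple of t^(n/(n-2)), and this power is at
    most r^-n when t <= r^-(n-2).  On the remaining compact interval f is bounded,
    and r^-n >= 1. *)
Lemma growth_bound (R : realType) (n : nat) (lambda c : R) (f : R -> R) :
  (2 < n)%N -> lambda <= n%:R / (n%:R - 2) -> 0 < c ->
  {within `]0, +oo[, continuous f} ->
  f =O_ (pinfty_nbhs R) (fun t : R => t `^ lambda) ->
  exists2 k, 0 <= k & forall t r, 0 < r <= 1 -> c <= t <= r ^- (n - 2) ->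
    f t <= k * r ^- n.
Proof.
move=> n2 hl c0 cf /eqO_exP[k1 k10 [T [_ hT]]].
have m0 : (0 < n - 2)%N by rewrite subn_gt0.
have nE : n%:R - 2 = (n - 2)%N%:R :> R by rewrite natrB// ltnW.
pose T1 := Num.max (Num.max (T + 1) 1) c.
have cT : c <= T1 by rewrite le_max lexx orbT.
have [x _ xmax] : exists2 x, x \in `[c, T1]%R & forall t, t \in `[c, T1]%R -> f t <= f x.
  apply: EVT_max => //; apply: continuous_subspaceW cf => t /=.
  by rewrite !in_itv /= => /andP[ct _]; rewrite (lt_le_trans c0 ct).
exists (k1 + `|f x|); first by rewrite addr_ge0// ltW.
move=> t r /andP[r0 r1] /andP[ct tr].
have rn1 : 1 <= r ^- n by rewrite invf_ge1 ?exprn_gt0// exprn_ile1// ltW.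
rewrite mulrDl; have [tT|Tt] := leP t T1.
  have ftx : f t <= f x by apply: xmax; rewrite in_itv /= ct.
  have : `|f x| * 1 <= `|f x| * r ^- n by rewrite ler_wpM2l.
  have : 0 <= k1 * r ^- n by rewrite mulr_ge0 ?(ltW k10)// (le_trans _ rn1).
  by have := ler_norm (f x); lra.
have : T < t by apply: lt_trans Tt; rewrite !lt_max ltrDl ltr01.
have t1 : 1 <= t by apply: le_trans (ltW Tt); rewrite !le_max lexx orbT.
move=> /hT; rewrite (ger0_norm (powR_ge0 _ _)) => ft.
have tl : t `^ lambda <= r ^- n.
  apply: le_trans (ler_powR t1 hl) _; rewrite nE.
  have t0 : 0 <= t by rewrite (le_trans _ t1).
  have q0 : 0 <= n%:R / (n - 2)%N%:R :> R by rewrite divr_ge0.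
  apply: le_trans (ge0_ler_powR q0 _ _ tr) _ => //.
    by rewrite nnegrE invr_ge0 exprn_ge0// ltW.
  rewrite -!powR_invn ?(ltW r0)// -powRrM.
  by rewrite mulNr mulrCA divff ?mulr1// pnatr_eq0 -lt0n.
have : k1 * t `^ lambda <= k1 * r ^- n by rewrite ler_pM2l.
have : 0 <= `|f x| * r ^- n by rewrite mulr_ge0// (le_trans _ rn1).
by have := ler_norm (f t); lra.
Qed.

(** The differential inequality -Delta u <= f(v), with the critical growth of f, in
    scale-covariant form: where v has height at most r^-(n-2), the Laplacian of u
    is at most of size r^-n. *)
Definition semilinear_bound (R : realType) (n : nat) (A : set 'rV[R]_n) (k : R)
    (u v : 'rV[R]_n -> R) : Prop :=
  forall x r, A x -> 0 < r <= 1 -> v x <= r ^- (n - 2) ->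
    exists2 L, - (k * r ^- n) <= L <= 0 & has_laplacian u x L.

Lemma semilinear_bound_of_growth (R : realType) (n : nat) (r0 lambda : R)
    (f : R -> R) (u v : 'rV[R]_n -> R) :
  (2 < n)%N -> 0 < r0 -> lambda <= n%:R / (n%:R - 2) ->
  {within `]0, +oo[, continuous f} ->
  f =O_ (pinfty_nbhs R) (fun t : R => t `^ lambda) ->
  superharmonic_on (punctured_ball r0) v ->
  (forall x, punctured_ball r0 x -> 0 < v x) ->
  (forall x, punctured_ball r0 x ->
    exists2 L, - f (v x) <= L <= 0 & has_laplacian u x L) ->
  exists2 k, 0 <= k & semilinear_bound (punctured_ball r0) k u v.
Proof.
move=> n2 r00 hl cf fO sv v0 hu.
have [c c0 cv] := superharmonic_lower_bound n2 r00 sv v0.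
have [k k0 fk] := growth_bound n2 hl c0 cf fO.
exists k => // x r Px r01 vr; have [L /andP[fL L0] uL] := hu x Px.
exists L => //; rewrite L0 andbT; apply: le_trans fL; rewrite lerN2.
by apply: fk => //; rewrite cv.
Qed.

Lemma semilinear_boundW (R : realType) (n : nat) (A : set 'rV[R]_n) (k k' : R)
    (u v : 'rV[R]_n -> R) :
  k <= k' -> semilinear_bound A k u v -> semilinear_bound A k' u v.
Proof.
move=> kk h x r Ax r01 vr; have [L /andP[kL L0] uL] := h x r Ax r01 vr.
exists L => //; rewrite L0 andbT; apply: le_trans kL; rewrite lerN2.
by case/andP: r01 => r0 _; rewrite ler_wpM2r// invr_ge0 exprn_ge0// ltW.
Qed.

(** * Selection of a peak, and the theorem *)

Lemma exists_expN_root (R : realType) (m : nat) (a : R) :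
  (0 < m)%N -> 0 < a -> exists2 r, 0 < r & r ^- m = a.
Proof.
move=> m0 a0; exists (a `^ (- m%:R^-1)); first exact: powR_gt0.
rewrite -powR_mulrn ?powR_ge0// -powRrM mulNr mulVf ?pnatr_eq0 -?lt0n//.
by rewrite powR_inv1 ?ltW// invrK.
Qed.

(** If max(u, v) is too large at xb, the maximum point x1 of the weighted function
    (s - |x - xb|)^m max(u, v) is a peak: within half of its distance d to the
    boundary of the cube the weight drops by a factor of at most 2^m, so
    max(u, v) is at most 2^m times its value at x1.  The larger
    component at x1 contradicts [no_peak]. *)
Lemma peak_selection (R : realType) (n : nat) (r0 k C rho0 : R)
    (u v : 'rV[R]_n -> R) :
  (2 < n)%N -> 0 < r0 -> 0 < C -> 0 < rho0 ->
  (forall x, punctured_ball r0 x -> {for x, continuous u} /\ 0 < u x) ->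
  (forall x, punctured_ball r0 x -> {for x, continuous v} /\ 0 < v x) ->
  semilinear_bound (punctured_ball r0) k u v ->
  semilinear_bound (punctured_ball r0) k v u ->
  no_peak C rho0 (k * 2 ^+ n) u -> no_peak C rho0 (k * 2 ^+ n) v ->
  exists2 B, 0 < B & exists2 rho1, 0 < rho1 &
    forall x : 'rV[R]_n, 0 < euclidean_norm x < rho1 ->
      u x <= B * euclidean_norm x ^- (n - 2) /\
      v x <= B * euclidean_norm x ^- (n - 2).
Proof.
move=> n2 r00 C0 rho00 hu hv lu lv npu npv.
set m := (n - 2)%N; have m0 : (0 < m)%N by rewrite subn_gt0.
set N : R := n%:R.
have N0 : 0 < N by rewrite ltr0n (leq_trans _ n2).
have N1 : 1 <= N by rewrite ler1n (leq_trans _ n2).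
(* The second summand makes r at most d / 2 below. *)
pose B := C + (4 * N) ^+ m.
have N4 : 0 < (4 * N) ^+ m by rewrite exprn_gt0// mulr_gt0.
have B0 : 0 < B by rewrite addr_gt0.
exists B => //.
exists (Num.min rho0 (Num.min 1 (r0 / (2 * N)))).
  by rewrite !lt_min rho00 ltr01 divr_gt0// mulr_gt0.
move=> xb; set rho := euclidean_norm xb; rewrite !lt_min.
move=> /andP[rhop /and3P[rho_lt rho_1]]; rewrite ltr_pdivlMr ?mulr_gt0// => rho_r.
have rhom0 : 0 < rho ^- m by rewrite invr_gt0 exprn_gt0.
pose M x := Num.max (u x) (v x).
suff : M xb <= B * rho ^- m by rewrite /M ge_max => /andP.
rewrite leNgt; apply/negP => hM.
pose s := rho / (2 * N).
have s0 : 0 < s by rewrite divr_gt0// mulr_gt0.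
have sN : s * (2 * N) = rho by rewrite /s divfK// gt_eqF// mulr_gt0.
have xbge : 2 * s <= `|xb|.
  have := euclidean_le_norm xb; rewrite -/rho -/N => rhoN.
  by rewrite -(ler_pM2l N0); apply: le_trans rhoN; lra.
have xble : `|xb| <= rho by exact: norm_le_euclidean.
have srho : s <= rho by have := ler_wpM2l (ltW s0) N1; lra.
have Qn x : `|x - xb| <= s -> s <= `|x| <= 2 * rho.
  move=> xs; apply/andP; split.
    have : `|xb| <= `|x| + `|x - xb|.
      by rewrite -{1}(subrK x xb) addrC distrC; exact: ler_normD.
    by lra.
  have : `|x| <= `|x - xb| + `|xb| by rewrite -{1}(subrK xb x); exact: ler_normD.
  by lra.
have QP x : `|x - xb| <= s -> punctured_ball r0 x.
  move=> /Qn /andP[sx xr]; split.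
    by rewrite -normr_gt0; exact: lt_le_trans sx.
  apply: le_trans (euclidean_le_norm x) _.
  by have := ler_wpM2l (ltW N0) xr; rewrite -/N; lra.
pose F x := (s - `|x - xb|) ^+ m * M x.
have [x1 /set_mem /= x1s Fmax] : exists2 x1, x1 \in [set x : 'rV[R]_n | `|x - xb| <= s]
    & forall x, x \in [set x : 'rV[R]_n | `|x - xb| <= s] -> F x <= F x1.
  apply: EVT_max_rV; first by exists xb; rewrite /= subrr normr0 ltW.
    exact: cube_compact.
  apply: continuous_in_subspaceT => x /set_mem /= xs.
  have [cu _] := hu x (QP x xs); have [cv _] := hv x (QP x xs).
  have cM : {for x, continuous M} by exact: (continuous_max cu cv).
  have cd : {for x, continuous (fun y : 'rV[R]_n => (s - `|y - xb|) ^+ m)}.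
    apply: (@continuous_comp _ _ _ (fun y : 'rV[R]_n => s - `|y - xb|) (fun t => t ^+ m)).
      apply: for_continuousB; first exact: for_continuous_cst.
      exact: norm_dist_continuous.
    exact: exprn_continuous.
  exact: (for_continuousM cd cM).
pose d := s - `|x1 - xb|.
have F1 : s ^+ m * (B * rho ^- m) < d ^+ m * M x1.
  apply: (@lt_le_trans _ _ (F xb)).
    by rewrite /F subrr normr0 subr0 ltr_pM2l// exprn_gt0.
  by apply: Fmax; rewrite inE /= subrr normr0 ltW.
have M1 : 0 < M x1 by rewrite lt_max; have [_ ->] := hu x1 (QP x1 x1s).
have d0 : 0 < d.
  rewrite lt_def subr_ge0 x1s andbT; apply: contraTneq F1 => ->.
  rewrite expr0n eqn0Ngt m0 mul0r -leNgt.
  by rewrite mulr_ge0//; [apply: exprn_ge0; exact: ltW|apply: mulr_ge0; exact: ltW].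
have ds : d <= s by rewrite gerBl.
have MB : B * rho ^- m < M x1.
  rewrite -(ltr_pM2l (exprn_gt0 m s0)); apply: lt_le_trans F1 _.
  by rewrite ler_pM2r// lerXn2r ?nnegrE ?(ltW s0) ?(ltW d0).
have [r rp rM] := exists_expN_root m0 M1.
have rd : r <= d / 2.
  rewrite leNgt; apply/negP => dr.
  have : d ^+ m * M x1 <= 2 ^+ m.
    rewrite -rM ler_pdivrMr ?exprn_gt0// -exprMn lerXn2r ?nnegrE ?(ltW d0)//.
      by rewrite mulr_ge0// ltW.
    by lra.
  have : 2 ^+ m <= s ^+ m * (B * rho ^- m).
    have -> : s ^+ m * (B * rho ^- m) = B / (2 * N) ^+ m.
      by rewrite -sN expNM; field; rewrite !expf_neq0// gt_eqF// mulr_gt0.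
    rewrite ler_pdivlMr ?exprn_gt0 ?mulr_gt0// -exprMn mulrA.
    by rewrite (_ : 2 * 2 * N = 4 * N) ?lerDr ?(ltW C0)//; ring.
  by move: F1; lra.
have r1 : 0 < r / 2 <= 1 by apply/andP; split; lra.
have Mr y : `|y - x1| <= r ->
    punctured_ball r0 y /\ M y <= 2 ^+ m * r ^- m.
  move=> yr.
  have yxb : `|y - xb| <= d / 2 + `|x1 - xb|.
    rewrite -(subrK x1 y) -addrA; apply: le_trans (ler_normD _ _) _.
    by rewrite lerD2r (le_trans yr).
  have ys : `|y - xb| <= s by move: yxb; rewrite /d; lra.
  split; first exact: QP.
  have My : 0 < M y by rewrite lt_max; have [_ ->] := hu y (QP y ys).
  have : (d / 2) ^+ m * M y <= d ^+ m * M x1.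
    apply: (@le_trans _ _ (F y)); last by apply: Fmax; rewrite inE.
    rewrite ler_pM2r// lerXn2r ?nnegrE ?divr_ge0 ?subr_ge0 ?(ltW d0)//.
    by move: yxb; rewrite /d; lra.
  rewrite rM exprMn exprVn -mulrA ler_pM2l ?exprn_gt0// mulrC ler_pdivrMr ?exprn_gt0//.
  by rewrite mulrC.
have r2m : (r / 2) ^- m = 2 ^+ m * r ^- m by rewrite expNM exprVn invrK mulrC.
have r2n : k * (r / 2) ^- n = k * 2 ^+ n * r ^- n.
  by rewrite expNM exprVn invrK [r ^- n * _]mulrC mulrA.
have tame (f g : 'rV[R]_n -> R) :
    (forall x, punctured_ball r0 x -> {for x, continuous f} /\ 0 < f x) ->
    semilinear_bound (punctured_ball r0) k f g ->
    (forall y, f y <= M y) -> (forall y, g y <= M y) ->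
    tame_on [set y | `|y - x1| <= r] (2 ^+ m * r ^- m) (k * 2 ^+ n * r ^- n) f.
  move=> hf lf fM gM y /= yr; have [Py My] := Mr y yr.
  have [cf fy] := hf y Py; split => //.
    by rewrite ltW//= (le_trans (fM y)).
  by rewrite -r2n; apply: (lf y (r / 2)) => //; rewrite r2m (le_trans (gM y)).
have [sx1 x1r] := andP (Qn x1 x1s).
have rr : 0 < r <= rho / (4 * N).
  have -> : rho / (4 * N) = s / 2 by rewrite /s; field; rewrite gt_eqF.
  by rewrite rp /=; lra.
have Crr : C * rho ^- m <= r ^- m.
  by rewrite rM; apply: le_trans (ltW MB); rewrite ler_pM2r// lerDl ltW.
have uM y : u y <= M y by rewrite le_max lexx.
have vM y : v y <= M y by rewrite le_max lexx orbT.
have rho2 : 0 < rho < rho0 by rewrite rhop.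
have [vu|uv] := leP (v x1) (u x1).
  apply: (npu x1 rho r) => //; last exact: (tame u v).
  by rewrite rM /M; apply/esym/max_idPl.
apply: (npv x1 rho r) => //; last exact: (tame v u).
by rewrite rM /M; apply/esym/max_idPr; exact: ltW.
Qed.

Lemma eqO_newton (R : realType) (n : nat) (B rho : R) (u : 'rV[R]_n -> R) :
  0 < B -> 0 < rho ->
  (forall x : 'rV[R]_n, 0 < euclidean_norm x < rho ->
    `|u x| <= B * euclidean_norm x ^- (n - 2)) ->
  u =O_ ((0 : 'rV[R]_n)^') (fun x => euclidean_norm x ^- (n - 2)).
Proof.
move=> B0 rho0 uB; apply/eqO_exP; exists B => //.
have n00 : euclidean_norm (0 : 'rV[R]_n) < rho.
  by apply: le_lt_trans (euclidean_le_norm _) _; rewrite normr0 mulr0.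
near=> x; have x0 : x != 0 by near: x; exact: nbhs_dnbhs_neq.
have xp := euclidean_norm_gt0 x0.
rewrite [X in _ * X]ger0_norm ?invr_ge0 ?exprn_ge0 ?euclidean_norm_ge0//.
apply: uB; rewrite xp /=; near: x; apply: nbhs_dnbhs.
exact: (cvgr_lt _ (@euclidean_norm_continuous R n 0)).
Unshelve. all: by end_near. Qed.

Theorem theorem3p1 (R : realType) (n : nat) (lambda sigma : R) (f g : R -> R)
    (U : set 'rV[R]_n) (u v : 'rV[R]_n -> R)
    (hn : (3 <= n)%N)
    (hsigma : 0 <= sigma) (hsl : sigma <= lambda)
    (hlambda : lambda <= n%:R / (n%:R - 2))
    (fpos : forall t : R, 0 < t -> 0 < f t)
    (gpos : forall t : R, 0 < t -> 0 < g t)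
    (fcont : {within `]0, +oo[, continuous f})
    (gcont : {within `]0, +oo[, continuous g})
    (fO : f =O_ (pinfty_nbhs R) (fun t : R => t `^ lambda))
    (gO : g =O_ (pinfty_nbhs R) (fun t : R => t `^ sigma))
    (Uopen : open U) (U0 : U 0)
    (uC2 : C_on 2 (U `\ 0) u) (vC2 : C_on 2 (U `\ 0) v)
    (upos : forall x : 'rV[R]_n, (U `\ 0) x -> 0 < u x)
    (vpos : forall x : 'rV[R]_n, (U `\ 0) x -> 0 < v x)
    (hu : forall x : 'rV[R]_n, (U `\ 0) x -> 0 <= - laplacian u x <= f (v x))
    (hv : forall x : 'rV[R]_n, (U `\ 0) x -> 0 <= - laplacian v x <= g (u x)) :
  (u =O_ ((0 : 'rV[R]_n)^') (fun x => euclidean_norm x ^- (n - 2))) /\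
  (v =O_ ((0 : 'rV[R]_n)^') (fun x => euclidean_norm x ^- (n - 2))).
Proof.
have oU : open (U `\ (0 : 'rV[R]_n)).
  apply: openI => //; apply: closed_openC.
  exact: accessible_closed_set1 (hausdorff_accessible (@norm_hausdorff _ _)) _.
have [e /= e0 eU] : exists2 e : R, 0 < e & ball (0 : 'rV[R]_n) e `<=` U.
  by have /nbhs_ballP[e e0 eU] := open_nbhs_nbhs (conj Uopen U0); exists e.
(* The sup-norm ball of radius e contains the Euclidean one. *)
pose r0 := e / 2; have r00 : 0 < r0 by rewrite divr_gt0.
have PU x : punctured_ball r0 x -> (U `\ (0 : 'rV[R]_n)) x.
  move=> [x0 xr]; split; last exact/eqP.
  apply: eU; rewrite -ball_normE /= sub0r normrN.
  by apply: le_lt_trans (norm_le_euclidean x) _; apply: le_lt_trans xr _; rewrite /r0; lra.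
have sh (w : 'rV[R]_n -> R) (F : 'rV[R]_n -> R) : C_on 2 (U `\ 0) w ->
    (forall x, (U `\ (0 : 'rV[R]_n)) x -> 0 <= - laplacian w x <= F x) ->
    superharmonic_on (punctured_ball r0) w /\
    (forall x, punctured_ball r0 x ->
       exists2 L, - F x <= L <= 0 & has_laplacian w x L).
  move=> wC2 hw.
  have hL x : punctured_ball r0 x -> [/\ has_laplacian w x (laplacian w x),
      laplacian w x <= 0 & - F x <= laplacian w x].
    move=> /PU Ux; have /andP[h1 h2] := hw x Ux; split; [|lra|lra].
    exact: C2_has_laplacian oU wC2 Ux.
  split=> x Px; have [h1 h2 h3] := hL x Px; last first.
    by exists (laplacian w x) => //; rewrite h3.
  by split; [have [+ _] := wC2; apply; exact: PU|exists (laplacian w x)].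
have [su lu] := sh u _ uC2 hu; have [sv lv] := sh v _ vC2 hv.
have up x : punctured_ball r0 x -> 0 < u x by move=> /PU; exact: upos.
have vp x : punctured_ball r0 x -> 0 < v x by move=> /PU; exact: vpos.
have n2 := hn; have gl := le_trans hsl hlambda.
have [ku ku0 bu] := semilinear_bound_of_growth n2 r00 hlambda fcont fO sv vp lu.
have [kv kv0 bv] := semilinear_bound_of_growth n2 r00 gl gcont gO su up lv.
pose k := Num.max ku kv.
have {}bu : semilinear_bound (punctured_ball r0) k u v.
  by apply: semilinear_boundW bu; rewrite le_max lexx.
have {}bv : semilinear_bound (punctured_ball r0) k v u.
  by apply: semilinear_boundW bv; rewrite le_max lexx orbT.
have k20 : 0 <= k * 2 ^+ n by rewrite mulr_ge0 ?exprn_ge0// le_max ku0.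
have [Cu Cu0 [ru ru0 npu]] := exists_no_peak n2 r00 k20 su up.
have [Cv Cv0 [rv rv0 npv]] := exists_no_peak n2 r00 k20 sv vp.
have C0 : 0 < Num.max Cu Cv by rewrite lt_max Cu0.
have rho0 : 0 < Num.min ru rv by rewrite lt_min ru0.
have [B B0 [rho1 rho10 uvB]] : exists2 B, 0 < B & exists2 rho1, 0 < rho1 &
    forall x : 'rV[R]_n, 0 < euclidean_norm x < rho1 ->
      u x <= B * euclidean_norm x ^- (n - 2) /\
      v x <= B * euclidean_norm x ^- (n - 2).
  apply: (peak_selection n2 r00 C0 rho0 _ _ bu bv).
  - by move=> x Px; have [+ _] := su x Px; split=> //; exact: up.
  - by move=> x Px; have [+ _] := sv x Px; split=> //; exact: vp.
  - by apply: no_peakW npu; rewrite ?le_max ?ge_min lexx.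
  - by apply: no_peakW npv; rewrite ?le_max ?ge_min lexx orbT.
have P1 x : 0 < euclidean_norm x < Num.min rho1 r0 ->
    0 < euclidean_norm x < rho1 /\ punctured_ball r0 x.
  rewrite lt_min => /and3P[x0 x1 xr]; rewrite x0 x1; split => //.
  by split; [exact: euclidean_norm_gt0_neq0|exact: ltW].
have m0 : 0 < Num.min rho1 r0 by rewrite lt_min rho10.
split; apply: (eqO_newton B0 m0) => x /P1[x1 Px].
  by rewrite gtr0_norm ?up//; have [] := uvB x x1.
by rewrite gtr0_norm ?vp//; have [] := uvB x x1.
Qed.
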